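(* Let $g\colon L\to K$ be a simplicial map between (possibly infinite) simplicial complexes. Let the vertex set of $L$ be $V$, and let the vertex set of $K$ be $W$. Suppose that for every finite $V_0\subseteq V$ and finite $W_0\subseteq W$, there exists a finite subset $V_1$ with $V_0\subseteq V_1\subseteq V$ and $W_0\subseteq g(V_1)\subseteq W$ such that the induced map $g_1\colon L[V_1]\to K[g(V_1)]$ is a homotopy equivalence. Then $g\colon L\to K$ is a homotopy equivalence.
   Context: For a simplicial complex $K$ with vertex set $V$ and $V'\subseteq V$, $K[V']$ denotes the induced subcomplex on the vertex subset $V'$. Simplicial complexes are identified with their geometric realizations, equipped with the topology of a CW complex. *)

(* Defs.v *)
From HB Require Import structures.
From mathcomp Require Import all_boot all_order all_algebra finmap.
From mathcomp Require Import boolp classical_sets functions cardinality fsbigop.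
From mathcomp Require Import set_interval reals topology normedtype.

Set Implicit Arguments.
Unset Strict Implicit.
Unset Printing Implicit Defensive.

Import Order.TTheory GRing.Theory Num.Theory.
Import numFieldNormedType.Exports.

Local Open Scope classical_set_scope.
Local Open Scope ring_scope.

(* The ambient type T may be larger than the vertex set, so that a complex and
   its induced subcomplexes live over the same type. *)
Record simplicial_complex (T : choiceType) := SimplicialComplex {
  faces : set {fset T};
  faces_neq0 : forall s : {fset T}, faces s -> s != fset0;
  faces_sub : forall s t : {fset T},
    faces s -> (t `<=` s)%fset -> t != fset0 -> faces t }.

Definition vertices (T : choiceType) (K : simplicial_complex T) : set T :=
  [set v | faces K [fset v]%fset].

Section induced.
Context (T : choiceType) (K : simplicial_complex T) (A : set T).

Let induced_faces : set {fset T} :=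
  [set s | faces K s /\ [set` s] `<=` A].

Let induced_neq0 (s : {fset T}) : induced_faces s -> s != fset0.
Proof. by move=> [/faces_neq0]. Qed.

Let induced_sub (s t : {fset T}) :
  induced_faces s -> (t `<=` s)%fset -> t != fset0 -> induced_faces t.
Proof.
move=> [Ks sA] ts t0; split; first exact: faces_sub Ks ts t0.
by move=> v /= vt; apply/sA/(fsubsetP ts).
Qed.

Definition induced : simplicial_complex T :=
  SimplicialComplex induced_neq0 induced_sub.

End induced.

(* Only the values on the vertices of L matter. *)
Record simplicial_map (T U : choiceType)
    (L : simplicial_complex T) (K : simplicial_complex U) := SimplicialMap {
  vertex_map :> T -> U;
  vertex_map_faces : forall s : {fset T},
    faces L s -> faces K [fset vertex_map v | v in s]%fset }.

Section induced_map.
Context (T U : choiceType) (L : simplicial_complex T) (K : simplicial_complex U).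
Context (g : simplicial_map L K) (A : set T).

Let induced_map_faces (s : {fset T}) : faces (induced L A) s ->
  faces (induced K (g @` A)) [fset g v | v in s]%fset.
Proof.
move=> [Ls sA]; split; first exact: vertex_map_faces.
by move=> w /= /imfsetP[v /= vs ->]; exists v => //; exact: sA.
Qed.

Definition induced_map : simplicial_map (induced L A) (induced K (g @` A)) :=
  SimplicialMap induced_map_faces.

End induced_map.

(* A point of the geometric realization is given by its barycentric
   coordinates. *)
Section realization.
Context (R : realType) (T : choiceType) (K : simplicial_complex T).

Definition closed_simplex (s : {fset T}) : set (T -> R) :=
  [set x | [/\ forall v, 0 <= x v,
               forall v, v \notin s -> x v = 0 &
               \sum_(v <- s) x v = 1]].

Definition realization : Type :=
  set_type (\bigcup_(s in faces K) closed_simplex s).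

HB.instance Definition _ := Choice.on realization.

Definition coords (x : realization) : T -> R := \val x.

(* The CW (coherent) topology: a set is open iff its trace on each closed
   simplex is open in that simplex.  The functions supported in a given finite
   set form a finite-dimensional space, on which the product topology is the
   Euclidean one. *)
Definition realization_open (A : set realization) : Prop :=
  forall s, faces K s ->
    exists2 O : set (prod_topology (fun _ : T => R)), open O &
      forall x : realization, closed_simplex s (coords x) ->
        (A x <-> O (coords x)).

Let realization_openT : realization_open setT.
Proof. by move=> s _; exists setT => //; exact: openT. Qed.

Let realization_openI : setI_closed realization_open.
Proof.
move=> A B oA oB s Ks.
have [O1 oO1 AO] := oA s Ks; have [O2 oO2 BO] := oB s Ks.
exists (O1 `&` O2); first exact: openI.
by move=> x xs; split=> -[/(AO x xs) ? /(BO x xs) ?].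
Qed.

Let realization_open_bigU (I : Type) (f : I -> set realization) :
  (forall i, realization_open (f i)) -> realization_open (\bigcup_i f i).
Proof.
move=> of_ s Ks.
pose O i := projT1 (cid2 (of_ i s Ks)).
exists (\bigcup_i O i).
  by apply: bigcup_open => i _; rewrite /O; case: cid2.
move=> x xs; split=> -[i _ xi]; exists i => //; move: xi;
  by rewrite /O; case: cid2 => /= P _ /(_ x xs)[].
Qed.

HB.instance Definition _ := isOpenTopological.Build realization
  realization_openT realization_openI realization_open_bigU.

End realization.

(* The map of realizations, affine on each simplex, that extends a simplicial
   map: the w-coordinate of the image of x is the sum of the coordinates of x
   over the fibre of w. *)
Section realize.
Context (R : realType) (T U : choiceType).
Context (L : simplicial_complex T) (K : simplicial_complex U).
Context (g : simplicial_map L K).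

Definition push_coords (x : T -> R) : U -> R :=
  fun w => \sum_(v \in g @^-1` [set w]) x v.

Lemma push_coordsE (s : {fset T}) (x : T -> R) (w : U) :
  closed_simplex s x -> push_coords x w = \sum_(v <- s | g v == w) x v.
Proof.
move=> [_ xs _]; rewrite /push_coords fsbig_mkcond.
rewrite -(fsbig_widen [set` s] setT) //; last first.
  move=> v [_ /negP vs] /=; rewrite patchE.
  by case: ifP => // _; exact: xs.
rewrite -fsbig_seq ?fset_uniq// [RHS]big_mkcond /=; apply: eq_bigr => v _.
rewrite patchE; case: ifPn; first by rewrite inE /= => ->; rewrite eqxx.
by rewrite notin_setE /= => /eqP/negbTE ->.
Qed.

Lemma push_coords_simplex (s : {fset T}) (x : T -> R) :
  closed_simplex s x -> closed_simplex [fset g v | v in s]%fset (push_coords x).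
Proof.
move=> sx; have [x0 xs x1] := sx; split.
- by move=> w; rewrite (push_coordsE _ sx) sumr_ge0.
- move=> w ws; rewrite (push_coordsE _ sx) big_seq_cond big1// => v.
  move=> /andP[vs /eqP gvw]; case/negP: ws.
  by apply/imfsetP; exists v.
- rewrite -x1; under eq_bigr do rewrite (push_coordsE _ sx).
  rewrite (exchange_big_dep predT)//= big_seq [RHS]big_seq.
  apply: eq_bigr => v vs.
  have gvs : g v \in [fset g v | v in s]%fset by apply/imfsetP; exists v.
  rewrite -big_filter (@perm_big _ _ _ _ _ [:: g v]) ?big_seq1//=.
  apply: uniq_perm; rewrite ?filter_uniq ?fset_uniq// => w.
  rewrite mem_filter inE eq_sym; case: eqP => [->|//]; by rewrite gvs.
Qed.

Let push_coords_realization (x : realization R L) :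
  push_coords (coords x) \in \bigcup_(s in faces K) @closed_simplex R U s.
Proof.
rewrite inE; have /set_mem[s Ls sx] := valP x.
exists [fset g v | v in s]%fset; first exact: vertex_map_faces.
exact: push_coords_simplex.
Qed.

Definition realize (x : realization R L) : realization R K :=
  exist _ (push_coords (coords x)) (push_coords_realization x).

End realize.

Arguments realize R {T U L K} g x.

Definition homotopic (R : realType) (X Y : topologicalType) (f g : X -> Y) :
    Prop :=
  exists H : X * R -> Y,
    [/\ {within [set: X] `*` `[0, 1]%classic, continuous H},
        forall x, H (x, 0) = f x &
        forall x, H (x, 1) = g x].

Definition homotopy_equivalence (R : realType) (X Y : topologicalType)
    (f : X -> Y) : Prop :=
  continuous f /\
  exists f' : Y -> X,
    [/\ continuous f', homotopic R (f' \o f) idfun &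
        homotopic R (f \o f') idfun].

(* Main.v *)
Require Import Defs.
From mathcomp Require Import all_boot all_order all_algebra finmap.
From mathcomp Require Import boolp classical_sets functions cardinality.
From mathcomp Require Import reals topology normedtype.
From mathcomp Require Import ring lra.

Set Implicit Arguments.
Unset Strict Implicit.
Unset Printing Implicit Defensive.

Import Order.TTheory GRing.Theory Num.Theory.
Import numFieldNormedType.Exports.

Local Open Scope classical_set_scope.
Local Open Scope ring_scope.

(* It suffices to deform cell by cell: if every pair of maps a : S -> |L| and
   b : D -> |K| on a cell D with boundary S, together with a homotopy from
   |g| a to the restriction of b, extends to a map D -> |L| and a homotopy on
   D, then extending over the simplices of K yields a right homotopy inverse g'
   of |g|, and extending over the cells s * [0, 1], for s a simplex of L, yields
   a homotopy from g' |g| to the identity.  A given lifting problem has compact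
   data, which live on finitely many vertices, so it can be solved in a finite
   stage where |g| restricts to a homotopy equivalence. *)

(** * Continuity on a subset *)

(** The homotopy inverses of different finite stages are unrelated, so they cannot be glued to an
    inverse of [realize R g]. What glues is a relative statement: [lifting] keeps the values on the
    boundary [S] exactly and accepts an arbitrary homotopy [h] there, so whatever was chosen on
    smaller cells is admissible data for the next one. Homotopy equivalences have this property
    because cells have the homotopy extension property, which turns an extension that is right on
    [S] only up to homotopy into one that is right on the nose. The construction over |L| x [0, 1]
    is relative as well: its values are prescribed at both ends, and it lies over the homotopy from
    |g| g' |g| to |g| produced by the first construction. *)

Definition cont_on (E Y : topologicalType) (A : set E) (f : E -> Y) : Prop :=
  forall x, A x -> f @ within A (nbhs x) --> f x.

Section cont_on.
Context {E Y : topologicalType}.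
Implicit Types (A B : set E) (f g : E -> Y).

Lemma cont_onE A f : cont_on A f <-> {within A, continuous f}.
Proof. exact: iff_sym (subspace_continuousP A f). Qed.

Lemma cont_onP A f : cont_on A f <->
  forall O : set Y, open O ->
    exists2 P : set E, open P & forall x, A x -> O (f x) <-> P x.
Proof.
rewrite cont_onE continuousP; split=> cf O oO.
  have /open_subspaceP[P oP PA] := cf O oO; exists P => // x Ax.
  have -> : O (f x) <-> (f @^-1` O `&` A) x by split=> [|[]].
  by rewrite -PA; split=> [[]|].
have [P oP PO] := cf O oO; apply/open_subspaceP; exists P => //.
by apply/seteqP; split=> x [Px Ax]; split=> //; apply/(PO x Ax).
Qed.

Lemma cont_on_closedP A f : cont_on A f <->
  forall C : set Y, closed C ->
    exists2 P : set E, closed P & forall x, A x -> C (f x) <-> P x.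
Proof.
rewrite cont_onP; split=> cf O oO.
  have [P oP PO] := cf (~` O) (closed_openC oO).
  exists (~` P); first exact: open_closedC.
  by move=> x Ax; rewrite /setC/= -(PO x Ax) /setC/= notK.
have [P oP PO] := cf (~` O) (open_closedC oO).
exists (~` P); first exact: closed_openC.
by move=> x Ax; rewrite /setC/= -(PO x Ax) /setC/= notK.
Qed.

Lemma continuous_cont_on A f : continuous f -> cont_on A f.
Proof. by move=> cf x _; apply: cvg_within_filter; exact: cf. Qed.

Lemma cont_onT f : cont_on setT f -> continuous f.
Proof. by move=> cf x; have := cf x I; rewrite withinET. Qed.

Lemma cont_on_sub A B f : A `<=` B -> cont_on B f -> cont_on A f.
Proof.
move=> AB /cont_onP cf; apply/cont_onP => O /cf[P oP PO].
by exists P => // x /AB; exact: PO.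
Qed.

Lemma cont_on_eq A f g : cont_on A f -> (forall x, A x -> f x = g x) ->
  cont_on A g.
Proof.
move=> /cont_onP cf fg; apply/cont_onP => O /cf[P oP PO].
by exists P => // x Ax; rewrite -fg//; exact: PO.
Qed.

Lemma cont_on_paste A B f : closed A -> closed B ->
  cont_on A f -> cont_on B f -> cont_on (A `|` B) f.
Proof. by rewrite !cont_onE; exact: withinU_continuous. Qed.

(** Closedness and continuity are proved together because pasting one more set requires the union of
    the others to be closed. *)
Lemma cont_on_bigU (I : eqType) (r : seq I) (A : I -> set E) f :
  (forall i, i \in r -> closed (A i)) ->
  (forall i, i \in r -> cont_on (A i) f) ->
  closed [set x | exists2 i, i \in r & A i x] /\
  cont_on [set x | exists2 i, i \in r & A i x] f.
Proof.
move=> cA cf; elim: r cA cf => [_ _|i r IH cA cf].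
  have -> : [set x | exists2 i, i \in [::] & A i x] = set0.
    by apply/seteqP; split=> x // [].
  by split; [exact: closed0|move=> x []].
have -> : [set x | exists2 j, j \in i :: r & A j x] =
    A i `|` [set x | exists2 j, j \in r & A j x].
  apply/seteqP; split=> x.
    by move=> [j]; rewrite inE => /orP[/eqP ->|jr] Ajx; [left|right; exists j].
  move=> [Aix|[j jr Ajx]]; [exists i|exists j] => //.
    by rewrite inE eqxx.
  by rewrite inE jr orbT.
have [|j jr|c1 c2] := IH.
- by move=> j jr; apply: cA; rewrite inE jr orbT.
- by apply: cf; rewrite inE jr orbT.
have cAi : closed (A i) by apply: cA; rewrite inE eqxx.
split; first exact: closedU.
by apply: cont_on_paste => //; apply: cf; rewrite inE eqxx.
Qed.

Lemma cont_on_cst A (y : Y) : cont_on A (fun=> y).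
Proof. by move=> x _; exact: cvg_cst. Qed.

Lemma cont_on_id A : cont_on A (fun x : E => x).
Proof. by move=> x _; exact: cvg_within. Qed.

End cont_on.

Arguments cont_on_cst {E Y} A y.
Arguments cont_on_id {E} A.

Section cont_on_comp.
Context {E F Y : topologicalType} (A : set E).

Lemma cont_on_comp (B : set F) (h : E -> F) (k : F -> Y) :
  cont_on A h -> (forall x, A x -> B (h x)) -> cont_on B k ->
  cont_on A (fun x => k (h x)).
Proof.
move=> /cont_onP ch AB /cont_onP ck; apply/cont_onP => O /ck[P oP PO].
have [Q oQ QP] := ch P oP; exists Q => // x Ax.
by rewrite -(QP x Ax); apply: PO; exact: AB.
Qed.

Lemma cont_on_compT (h : E -> F) (k : F -> Y) :
  cont_on A h -> continuous k -> cont_on A (fun x => k (h x)).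
Proof.
move=> ch ck; apply: (cont_on_comp (B := setT)) => //.
exact: continuous_cont_on.
Qed.

Lemma cont_on_pair (h : E -> F) (k : E -> Y) :
  cont_on A h -> cont_on A k -> cont_on A (fun x => (h x, k x)).
Proof. by move=> ch ck x Ax; apply: cvg_pair; [exact: ch|exact: ck]. Qed.

End cont_on_comp.

Lemma cont_on_fst (E F : topologicalType) (A : set (E * F)) :
  cont_on A (fun p => p.1).
Proof. by apply: continuous_cont_on => x; exact: cvg_fst. Qed.
Arguments cont_on_fst {E F} A.

Lemma cont_on_snd (E F : topologicalType) (A : set (E * F)) :
  cont_on A (fun p => p.2).
Proof. by apply: continuous_cont_on => x; exact: cvg_snd. Qed.
Arguments cont_on_snd {E F} A.

Lemma continuous_preimage_open (E F : topologicalType) (f : E -> F)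
    (O : set F) : continuous f -> open O -> open (f @^-1` O).
Proof. by move=> /continuousP; exact. Qed.

Lemma continuous_preimage_closed (E F : topologicalType) (f : E -> F)
    (C : set F) : continuous f -> closed C -> closed (f @^-1` C).
Proof. by move=> /continuous_closedP; exact. Qed.

Section real_valued.
Context {R : realType} {E : topologicalType} (A : set E).
Implicit Types f g : E -> R.

Lemma cont_onD f g : cont_on A f -> cont_on A g ->
  cont_on A (fun x => f x + g x).
Proof. by move=> cf cg x Ax; apply: cvgD; [exact: cf|exact: cg]. Qed.

Lemma cont_onN f : cont_on A f -> cont_on A (fun x => - f x).
Proof. by move=> cf x Ax; apply: cvgN; exact: cf. Qed.

Lemma cont_onM f g : cont_on A f -> cont_on A g ->
  cont_on A (fun x => f x * g x).
Proof. by move=> cf cg x Ax; apply: cvgM; [exact: cf|exact: cg]. Qed.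

Lemma cont_onV f : (forall x, A x -> f x != 0) -> cont_on A f ->
  cont_on A (fun x => (f x)^-1).
Proof. by move=> f0 cf x Ax; apply: cvgV; [exact: f0|exact: cf]. Qed.

Lemma cont_on_min f g : cont_on A f -> cont_on A g ->
  cont_on A (fun x => Num.min (f x) (g x)).
Proof.
move=> cf cg.
apply: (cont_on_compT (k := fun p : R * R => Num.min p.1 p.2)
  (cont_on_pair cf cg)).
exact: min_continuous.
Qed.

Lemma cont_on_max f g : cont_on A f -> cont_on A g ->
  cont_on A (fun x => Num.max (f x) (g x)).
Proof.
move=> cf cg.
apply: (cont_on_compT (k := fun p : R * R => Num.max p.1 p.2)
  (cont_on_pair cf cg)).
exact: max_continuous.
Qed.

Lemma cont_on_sum (I : Type) (r : seq I) (f : I -> E -> R) :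
  (forall i, cont_on A (f i)) -> cont_on A (fun x => \sum_(i <- r) f i x).
Proof.
move=> cf; elim: r => [|i r IH].
  have c0 := cont_on_cst A (0 : R).
  by apply: (cont_on_eq c0) => x _; rewrite big_nil.
by apply: (cont_on_eq (cont_onD (cf i) IH)) => x _; rewrite big_cons.
Qed.

End real_valued.

(** * Convex cells and homotopy extension *)

Lemma closedX (E F : topologicalType) (A : set E) (B : set F) :
  closed A -> closed B -> closed (A `*` B).
Proof.
move=> cA cB; have -> : A `*` B = (fst @^-1` A) `&` (snd @^-1` B) by [].
by apply: closedI; apply: continuous_preimage_closed => // p;
  [exact: cvg_fst|exact: cvg_snd].
Qed.

Section radial_cells.
Context {R : realType}.

Definition unitI : set R := [set t | 0 <= t <= 1].

Lemma unitI0 : unitI 0. Proof. by rewrite /unitI/= lexx ler01. Qed.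
Lemma unitI1 : unitI 1. Proof. by rewrite /unitI/= lexx ler01. Qed.

Lemma unitIE : unitI = `[0, 1]%classic.
Proof. by apply/seteqP; split=> t; rewrite /= in_itv. Qed.

Lemma compact_unitI : compact unitI.
Proof. by rewrite unitIE; exact: segment_compact. Qed.
Arguments compact_unitI : clear implicits.

Lemma closed_unitI : closed unitI.
Proof. by rewrite unitIE; exact: itv_closed. Qed.
Arguments closed_unitI : clear implicits.

Lemma closed_zero : closed [set (0 : R)].
Proof. exact: closed_eq. Qed.
Arguments closed_zero : clear implicits.

(** [1 - tent t] is |2 t - 1|, the Minkowski functional of [0, 1] about its midpoint; [tent] is the
    function [m] of the interval seen as a cell. *)
Definition tent (t : R) : R := Num.min (2 * t) (2 - 2 * t).

Lemma tent_scale (l t : R) : 0 <= l ->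
  tent (1 / 2 + l * (t - 1 / 2)) = 1 - l * (1 - tent t).
Proof.
move=> l0; rewrite /tent.
by case: (leP (2 * t) (2 - 2 * t)) => ?; [rewrite min_l|rewrite min_r]; nra.
Qed.

(** The pairs (x, l) such that the homothety of ratio l about the centre keeps x inside [D]: it
    multiplies the Minkowski functional [1 - m x] by l. *)
Definition scalable (E : Type) (D : set E) (m : E -> R) : set (E * R) :=
  [set p | [/\ D p.1, 0 <= p.2 & p.2 * (1 - m p.1) <= 1]].

(* Abstract radial structure of a convex body D with boundary S: s (x, l) is
   the image of x under the homothety of ratio l about an interior point c,
   and 1 - m is the Minkowski functional of D about c. *)
Definition radial (E : topologicalType) (D S : set E) (m : E -> R)
    (s : E * R -> E) : Prop :=
  [/\ cont_on D m /\ cont_on (scalable D m) s,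
      forall x, D x -> 0 <= m x <= 1,
      forall x, S x <-> D x /\ m x = 0,
      forall p, scalable D m p -> D (s p) /\ m (s p) = 1 - p.2 * (1 - m p.1) &
      forall x, D x -> s (x, 1) = x].

Definition cell (E : topologicalType) (D S : set E) : Prop :=
  [/\ closed D, compact D & exists m s, radial D S m s].

Section cell.
Context {E : topologicalType} (D S : set E) (cDS : cell D S).

Lemma cell_closed : closed D. Proof. by case: cDS. Qed.
Arguments cell_closed : clear implicits.

Lemma cell_compact : compact D. Proof. by case: cDS. Qed.
Arguments cell_compact : clear implicits.

Lemma cell_sub : S `<=` D.
Proof. by case: cDS => _ _ [m [s [_ _ mS _ _]]] x /mS[]. Qed.

Lemma cell_boundary_closed : closed S.
Proof.
case: cDS => cD _ [m [s [[/cont_on_closedP cm _] _ mS _ _]]].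
have [P cP PD] := cm [set 0] closed_zero.
suff -> : S = D `&` P by exact: closedI.
apply/seteqP; split=> x.
  by move=> /mS[Dx mx]; split=> //; exact/(PD x Dx).
by move=> [Dx Px]; apply/mS; split=> //; exact/(PD x Dx).
Qed.
Arguments cell_boundary_closed : clear implicits.

Lemma cell_boundary_compact : compact S.
Proof.
exact: subclosed_compact cell_boundary_closed cell_compact cell_sub.
Qed.
Arguments cell_boundary_compact : clear implicits.

(* Pull back along the retraction of D * [0, 1] onto D * {0} \cup S * [0, 1]
   that projects from the point (c, 2). *)
Lemma cell_homotopy_extension (Y : topologicalType) (k : E -> Y)
    (h : E * R -> Y) :
  cont_on D k -> cont_on (S `*` unitI) h -> (forall x, S x -> h (x, 0) = k x) ->
  exists H : E * R -> Y, [/\ cont_on (D `*` unitI) H,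
    forall x, D x -> H (x, 0) = k x &
    forall x t, S x -> unitI t -> H (x, t) = h (x, t)].
Proof.
move=> ck ch hk; have cS := cell_boundary_closed; have sSD := cell_sub.
have [cD _ [m [s [[cm cs] m01 mS sD s1]]]] := cDS.
(* The ray from (c, 2) through (x, t) is (c + l (x - c), 2 - l (2 - t)). It meets the bottom at l =
   1 / (1 - t / 2) and the side at l = 1 / (1 - m x); the first hit has the smaller l, hence the
   larger denominator [d]. *)
pose d (p : E * R) : R := Num.max (1 - p.2 / 2) (1 - m p.1).
pose l p := (d p)^-1.
pose rho p := (s (p.1, l p), 2 - l p * (2 - p.2)).
pose J : set (E * R) := (D `*` [set 0]) `|` (S `*` unitI).
pose kh (p : E * R) : Y := if p.2 == 0 then k p.1 else h p.
have d_ge p : unitI p.2 -> 1 / 2 <= d p.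
  by move=> /andP[_ p1]; rewrite le_max; apply/orP; left; lra.
have d_gt p : unitI p.2 -> 0 < d p.
  by move=> /d_ge; apply: lt_le_trans; lra.
have l_gt p : unitI p.2 -> 0 < l p by move=> /d_gt; rewrite invr_gt0.
have sc p : D p.1 -> unitI p.2 -> scalable D m (p.1, l p).
  move=> Dp Ip; split=> //=; first exact/ltW/l_gt.
  by rewrite mulrC ler_pdivrMr ?d_gt// mul1r le_max lexx orbT.
have rhoJ p : (D `*` unitI) p -> J (rho p).
  move=> [Dp Ip]; have [sDp msp] := sD _ (sc p Dp Ip).
  have := m01 _ Dp; case/andP: (Ip) => p0 p1 /andP[mp0 mp1].
  have dl : l p * d p = 1 by rewrite mulVf// gt_eqF// d_gt.
  rewrite /J/rho/=.
  case: (leP (1 - p.2 / 2) (1 - m p.1)) => dp; last first.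
    left; split=> //=; move: dl; rewrite /d max_l; last exact: ltW.
    by nra.
  right; split; first by apply/mS; split=> //; rewrite msp/=; move: dl;
    rewrite /d max_r//; lra.
  move: dl (l_gt p Ip); rewrite /d max_r// /unitI/= => dl l0; apply/andP; split.
    by nra.
  by nra.
have ckh : cont_on J kh.
  apply: cont_on_paste.
  - exact: closedX cD closed_zero.
  - exact: closedX cS closed_unitI.
  - apply: (@cont_on_eq _ _ _ (fun p => k p.1)).
      apply: cont_on_comp ck; last by move=> p [].
      exact: cont_on_fst.
    by move=> p [_ /= p0]; rewrite /kh p0 eqxx.
  - apply: (cont_on_eq ch) => -[x t] [/= Sx _]; rewrite /kh/=.
    by case: eqP => // ->; rewrite hk.
have c1 : cont_on (D `*` unitI) (fun p : E * R => p.1).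
  exact: cont_on_fst.
have c2 : cont_on (D `*` unitI) (fun p : E * R => p.2).
  exact: cont_on_snd.
have cd : cont_on (D `*` unitI) d.
  apply: cont_on_max.
    by apply: cont_onD (cont_on_cst _ _) _; apply: cont_onN;
      apply: cont_onM c2 (cont_on_cst _ _).
  apply: cont_onD (cont_on_cst _ _) _; apply: cont_onN.
  by apply: cont_on_comp cm => // p [].
have cl : cont_on (D `*` unitI) l.
  by apply: cont_onV cd => p [_ Ip]; rewrite gt_eqF// d_gt.
have crho : cont_on (D `*` unitI) rho.
  apply: cont_on_pair.
    by apply: cont_on_comp (cont_on_pair c1 cl) _ cs => p [Dp Ip]; exact: sc.
  apply: cont_onD (cont_on_cst _ _) _; apply: cont_onN; apply: cont_onM cl _.
  by apply: cont_onD (cont_on_cst _ _) _; exact: cont_onN.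
exists (kh \o rho); split.
- exact: cont_on_comp crho rhoJ ckh.
- move=> x Dx; have /andP[mx0 mx1] := m01 _ Dx.
  have l1 : l (x, 0) = 1.
    by rewrite /l/d/= max_l; [rewrite mul0r subr0 invr1|lra].
  by rewrite /rho/= l1 s1// /kh/= ifT//; apply/eqP; lra.
- move=> x t Sx It; have /mS[Dx mx0] := Sx.
  have /andP[t0 t1] := It.
  have l1 : l (x, t) = 1.
    by rewrite /l/d/= mx0 max_r; [rewrite subr0 invr1|lra].
  rewrite /rho/= l1 s1// mul1r (_ : 2 - (2 - t) = t); last by lra.
  by rewrite /kh/=; case: eqP => // ->; rewrite hk.
Qed.

Definition cylinder_boundary : set (E * R) :=
  [set p | S p.1 /\ unitI p.2 \/ D p.1 /\ (p.2 = 0 \/ p.2 = 1)].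

(** The Minkowski functional of a product of convex bodies is the maximum of those of the factors,
    so [m'] is a minimum; the centre is (c, 1 / 2). *)
Lemma cell_cylinder : cell (D `*` unitI) cylinder_boundary.
Proof.
have [cD kD [m [s [[cm cs] m01 mS sD s1]]]] := cDS.
split; [exact: closedX cD closed_unitI|exact: compact_setX kD compact_unitI|].
pose e := tent.
pose m' (p : E * R) : R := Num.min (m p.1) (e p.2).
pose s' (q : (E * R) * R) : E * R :=
  (s (q.1.1, q.2), 1 / 2 + q.2 * (q.1.2 - 1 / 2)).
have e1 t : e t <= 1.
  by rewrite /e/tent; case: (leP (2 * t)) => ?; lra.
have e0 t : 0 <= e t <-> unitI t.
  rewrite /e/tent le_min; split=> /andP[a b]; apply/andP; split; lra.
have mE (l a b : R) : 0 <= l ->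
    Num.min (1 - l * (1 - a)) (1 - l * (1 - b)) = 1 - l * (1 - Num.min a b).
  move=> l0; case: (leP a b) => ab; [rewrite min_l//|rewrite min_r//].
    by rewrite lerD2l lerN2 ler_wpM2l//; lra.
  by rewrite lerD2l lerN2 ler_wpM2l//; lra.
have sc q : scalable (D `*` unitI) m' q -> scalable D m (q.1.1, q.2).
  move=> [[/= D1 I1] q0 q1]; split=> //=; apply: le_trans q1.
  by rewrite ler_wpM2l// lerD2l lerN2 ge_min lexx.
exists m', s'; split; first split.
- apply: cont_on_min.
    by apply: cont_on_comp (cont_on_fst _) _ cm => p [].
  have c2 : cont_on (D `*` unitI) (fun p : E * R => p.2).
    exact: cont_on_snd.
  apply: cont_on_min; first exact: cont_onM (cont_on_cst _ _) c2.
  apply: cont_onD (cont_on_cst _ _) _; apply: cont_onN.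
  exact: cont_onM (cont_on_cst _ _) c2.
- have c1 := cont_on_fst (scalable (D `*` unitI) m').
  have c2 := cont_on_snd (scalable (D `*` unitI) m').
  have c11 := cont_on_comp c1 (fun _ _ => I) (cont_on_fst setT).
  have c12 := cont_on_comp c1 (fun _ _ => I) (cont_on_snd setT).
  apply: cont_on_pair.
    by apply: cont_on_comp (cont_on_pair c11 c2) _ cs => q; exact: sc.
  apply: cont_onD (cont_on_cst _ _) _; apply: cont_onM c2 _.
  exact: cont_onD c12 (cont_on_cst _ _).
- move=> [x t] [/= Dx It]; have /andP[mx0 mx1] := m01 _ Dx.
  by rewrite le_min mx0 ge_min mx1 andbT; exact/e0.
- move=> [x t]; rewrite /cylinder_boundary /m' /=; split.
    move=> [[/mS[Dx mx0] It]|[Dx t01]].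
      by split=> //; rewrite mx0 min_l//; exact/e0.
    have It : unitI t by case: t01 => ->; [exact: unitI0|exact: unitI1].
    have et : e t = 0.
      by case: t01 => ->; rewrite /e/tent; [rewrite min_l|rewrite min_r]; lra.
    by split=> //; rewrite et min_r//; case/andP: (m01 _ Dx).
  move=> [[/= Dx It]]; case: (leP (m x) (e t)) => _ h0.
    by left; split=> //; apply/mS.
  right; split=> //; move: h0; rewrite /e/tent.
  by case: (leP (2 * t)) => _ ?; [left|right]; lra.
- move=> q qs; have [sDq msq] := sD _ (sc _ qs); have [[/= Dq Iq] q0 q1] := qs.
  have m'E : m' (s' q) = 1 - q.2 * (1 - m' q.1).
    by rewrite /m'/e/= tent_scale// msq mE.
  split=> //; split=> //; apply/e0.
  have : 0 <= m' (s' q) by rewrite m'E; lra.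
  by rewrite /m' le_min => /andP[].
- by move=> [x t] [/= Dx It]; rewrite /s'/= s1// mul1r; congr pair; lra.
Qed.

End cell.
End radial_cells.

Arguments unitI {R}.
Arguments cell R {E} D S.

(** * Lifting against homotopy equivalences *)

Section clip.
Context {R : realType}.

(** Homotopies are controlled only on [0, 1], while [cont_on_if] wants both branches continuous on
    the whole set. Clipping the parameter makes each branch continuous also where the other one is
    selected. *)
Definition clip (t : R) : R := Num.max 0 (Num.min t 1).

Lemma clip_unitI (t : R) : unitI (clip t).
Proof.
by rewrite /unitI/clip/= le_max lexx /= ge_max ler01 ge_min lexx orbT.
Qed.

Lemma clip_id (t : R) : unitI t -> clip t = t.
Proof. by move=> /andP[t0 t1]; rewrite /clip min_l// max_r. Qed.

Lemma cont_on_clip (E : topologicalType) (A : set E) (u : E -> R) :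
  cont_on A u -> cont_on A (fun x => clip (u x)).
Proof.
move=> cu; apply: cont_on_max (cont_on_cst _ _) _.
exact: cont_on_min cu (cont_on_cst _ _).
Qed.

Lemma cont_on_clip_homotopy (E F Y : topologicalType) (A : set E) (B : set F)
    (h : F * R -> Y) (f : E -> F) (u : E -> R) :
  cont_on (B `*` unitI) h -> cont_on A f -> (forall x, A x -> B (f x)) ->
  cont_on A u -> cont_on A (fun x => h (f x, clip (u x))).
Proof.
move=> ch cf AB cu.
apply: cont_on_comp (cont_on_pair cf (cont_on_clip cu)) _ ch.
by move=> x Ax; split; [exact: AB|exact: clip_unitI].
Qed.

Lemma cont_on_if (E Y : topologicalType) (A : set E) (u : E -> R) (c : R)
    (f g : E -> Y) :
  closed A -> cont_on A u -> cont_on A f -> cont_on A g ->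
  (forall x, A x -> u x = c -> f x = g x) ->
  cont_on A (fun x => if u x <= c then f x else g x).
Proof.
move=> cA /cont_on_closedP cu cf cg fg.
have [P cP PA] := cu [set t | t <= c] (@closed_le _ c).
have [Q cQ QA] := cu [set t | t >= c] (@closed_ge _ c).
have -> : A = (A `&` P) `|` (A `&` Q).
  apply/seteqP; split=> x; last by move=> [[]|[]].
  by move=> Ax; case: (leP (u x) c) => [uc|/ltW uc]; [left|right]; split=> //;
    [apply/PA|apply/QA].
apply: cont_on_paste; [exact: closedI|exact: closedI| |].
  apply: (cont_on_eq (cont_on_sub (@subIsetl _ A P) cf)) => x [Ax Px].
  by rewrite ifT//; apply/(PA x Ax).
apply: (cont_on_eq (cont_on_sub (@subIsetl _ A Q) cg)) => x [Ax Qx].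
case: ifP => // uc; rewrite fg//; apply/eqP; rewrite eq_le uc/=.
exact/(QA x Ax).
Qed.

End clip.

Section lifting.
Context {R : realType}.

(** This is the homotopy extension and lifting property of the pair (D, S) along [f]. *)
Definition lifting (X Y E : topologicalType) (D S : set E) (f : X -> Y) :
    Prop :=
  forall (a : E -> X) (b : E -> Y) (h : E * R -> Y),
    cont_on S a -> cont_on D b -> cont_on (S `*` unitI) h ->
    (forall x, S x -> h (x, 0) = f (a x) /\ h (x, 1) = b x) ->
    exists (a' : E -> X) (H : E * R -> Y),
      [/\ cont_on D a' /\ cont_on (D `*` unitI) H,
          forall x, S x -> a' x = a x,
          forall x t, S x -> unitI t -> H (x, t) = h (x, t) &
          forall x, D x -> H (x, 0) = f (a' x) /\ H (x, 1) = b x].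

Section homotopic_to_identity.
Context {X : topologicalType} (phi : X -> X) (beta : X * R -> X).
Hypothesis cbeta : cont_on (setT `*` unitI) beta.
Hypothesis beta0 : forall x, beta (x, 0) = phi x.
Hypothesis beta1 : forall x, beta (x, 1) = x.
Context {E : topologicalType} (D S : set E) (cDS : cell R D S).

(** On [S], [beta] moves [phi (a x)], which extends over [D] by [k], to [a x]. Homotopy extension
    carries [k] along, and its end extends [a]. *)
Lemma homotopic_id_extension (a k : E -> X) :
  cont_on S a -> cont_on D k -> (forall x, S x -> phi (a x) = k x) ->
  exists2 a', cont_on D a' & forall x, S x -> a' x = a x.
Proof.
move=> ca ck ak.
have cb : cont_on (S `*` unitI) (fun p => beta (a p.1, p.2)).
  apply: cont_on_comp cbeta; last by move=> p [].
  apply: cont_on_pair (cont_on_snd _).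
  by apply: cont_on_comp (cont_on_fst _) _ ca => p [].
have [|G [cG G0 GS]] := cell_homotopy_extension cDS ck cb.
  by move=> x Sx; rewrite /= beta0 ak.
exists (fun x => G (x, 1)).
  apply: cont_on_comp cG; last by move=> x Dx; split=> //; exact: unitI1.
  exact: cont_on_pair (cont_on_id _) (cont_on_cst _ _).
by move=> x Sx; rewrite GS//= ?beta1//; exact: unitI1.
Qed.

(** Dragging [b] backwards along [h] and then forwards along [beta] gives an extension of [a], but
    the resulting homotopy to [b] restricts on [S] to [h] preceded by a detour. Homotopy extension
    on the cylinder over [D] removes the detour. *)
Lemma homotopic_id_lifting : lifting D S phi.
Proof.
move=> a b h ca cb ch hab.
have cD := cell_closed cDS; have cS := cell_boundary_closed cDS.
have SD := cell_sub cDS.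
have cI := @closed_unitI R.
pose bt (x : X) (t : R) := beta (x, clip t).
have bt0 x (t : R) : t = 0 -> bt x t = phi x.
  by move=> ->; rewrite /bt clip_id ?beta0//; exact: unitI0.
have bt1 x (t : R) : t = 1 -> bt x t = x.
  by move=> ->; rewrite /bt clip_id ?beta1//; exact: unitI1.
pose h' (x : E) (t : R) := h (x, clip t).
have h'0 x (t : R) : S x -> t = 0 -> h' x t = phi (a x).
  by move=> Sx ->; rewrite /h' clip_id; [case: (hab x Sx)|exact: unitI0].
have h'1 x (t : R) : S x -> t = 1 -> h' x t = b x.
  by move=> Sx ->; rewrite /h' clip_id; [case: (hab x Sx)|exact: unitI1].
have cbt (F : topologicalType) (A : set F) f u : cont_on A f -> cont_on A u ->
    cont_on A (fun x => bt (f x) (u x)).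
  by move=> cf cu; apply: cont_on_clip_homotopy cbeta cf _ cu.
have ch' (F : topologicalType) (A : set F) f u : cont_on A f -> cont_on A u ->
    (forall x, A x -> S (f x)) -> cont_on A (fun x => h' (f x) (u x)).
  by move=> cf cu fS; apply: cont_on_clip_homotopy ch cf fS cu.
(* On [S] the homotopy goes from [b] back to [phi a] along [h], then to [a] along [beta]; its end on
   [D] is [a1]. *)
have [|| G [cG G0 GS]] := @cell_homotopy_extension R E D S cDS X b
    (fun p => if 2 * p.2 <= 1 then h' p.1 (1 - 2 * p.2)
              else bt (a p.1) (2 * p.2 - 1)) cb.
- have c2 := cont_on_snd (S `*` @unitI R).
  have cu := cont_onM (cont_on_cst _ (2 : R)) c2.
  apply: cont_on_if => //.
  + exact: closedX.
  + apply: ch'; [exact: cont_on_fst| |by move=> p []].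
    by apply: cont_onD (cont_on_cst _ _) _; exact: cont_onN.
  + apply: cbt; last exact: cont_onD cu (cont_on_cst _ _).
    by apply: cont_on_comp (cont_on_fst _) _ ca => p [].
  + by move=> p [Sp Ip] p2; rewrite h'0// ?bt0//; lra.
- by move=> x Sx /=; rewrite mulr0 ler01 h'1//; lra.
pose a1 x := G (x, 1).
have ca1 : cont_on D a1.
  apply: cont_on_comp cG; last by move=> x Dx; split=> //; exact: unitI1.
  exact: cont_on_pair (cont_on_id _) (cont_on_cst _ _).
have a1S x : S x -> a1 x = a x.
  move=> Sx; rewrite /a1 GS//=; last exact: unitI1.
  by rewrite ifF ?bt1//; [lra|apply/negbTE; rewrite -ltNge; lra].
(* On S the concatenation P runs along beta, back along beta, and then along
   h; N contracts the first two parts. *)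
pose P (p : E * R) : X := if 3 * p.2 <= 1 then bt (a1 p.1) (3 * p.2)
  else G (p.1, clip ((3 - 3 * p.2) / 2)).
(* For w = 0, [tau] is 3 t and [N] is [P]; for w = 1 it is 2 + t, so only [h] remains. The minimum
   is the height reached by the detour along [beta]; at t = 0 it is 0 and at t = 1 [tau] is 3, for
   all w, so the ends of the path stay fixed. *)
pose tau (q : (E * R) * R) : R := 3 * q.1.2 + q.2 * (2 - 2 * q.1.2).
pose N (q : (E * R) * R) : X :=
  if tau q <= 2
  then bt (a q.1.1) (Num.min (tau q - 2 * q.2) (2 - tau q))
  else h' q.1.1 (tau q - 2).
have P0 x : D x -> P (x, 0) = phi (a1 x).
  by move=> Dx; rewrite /P/= mulr0 ler01 bt0.
have P1 x : D x -> P (x, 1) = b x.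
  move=> Dx; rewrite /P/= mulr1 subrr mul0r clip_id ?G0//; last exact: unitI0.
  by rewrite ifF//; apply/negbTE; rewrite -ltNge; lra.
have cP : cont_on (D `*` unitI) P.
  have c2 := cont_on_snd (D `*` @unitI R).
  have cu := cont_onM (cont_on_cst _ (3 : R)) c2.
  apply: cont_on_if => //.
  - exact: closedX.
  - apply: cbt => //.
    by apply: cont_on_comp (cont_on_fst _) _ ca1 => p [].
  - apply: cont_on_clip_homotopy cG (cont_on_fst _) _ _; first by move=> p [].
    apply: cont_onM (cont_on_cst _ _).
    by apply: cont_onD (cont_on_cst _ _) _; exact: cont_onN.
  - move=> p [Dp Ip] p2; rewrite bt1// p2 (_ : (3 - 1) / 2 = 1) ?clip_id//.
      exact: unitI1.
    lra.
(* A homotopy with parameter w on the boundary of the cylinder: [N] on the sides, constant on both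
   ends. *)
pose M q := if `[< S q.1.1 >] then N q else P q.1.
have N_end x t w : S x -> unitI w -> t = 0 \/ t = 1 ->
    N ((x, t), w) = P (x, t).
  move=> Sx /andP[w0 w1] [->|->].
    rewrite P0 ?a1S//; last exact: SD.
    rewrite /N/tau/= !mulr0 !add0r subr0 ifT; last by lra.
    by rewrite bt0// min_l; lra.
  rewrite P1; last exact: SD.
  rewrite /N/tau/= ifF; last by apply/negbTE; rewrite -ltNge; lra.
  by rewrite h'1//; lra.
have cM : cont_on (cylinder_boundary D S `*` unitI) M.
  have -> : cylinder_boundary D S `*` unitI =
      ((S `*` unitI) `*` unitI) `|` ((D `*` [set (0 : R); 1]) `*` @unitI R).
    by apply/seteqP; split=> -[[x t] w] /=; rewrite /cylinder_boundary/=;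
      tauto.
  apply: cont_on_paste.
  - by do 2 apply: closedX => //.
  - do 2 apply: closedX => //; apply: closedU; first exact: closed_zero.
    exact: closed_eq.
  - apply: (@cont_on_eq _ _ _ N) => [|q [[Sq _] _]]; last by rewrite /M asboolT.
    have c1 := cont_on_fst ((S `*` @unitI R) `*` @unitI R).
    have c2 := cont_on_snd ((S `*` @unitI R) `*` @unitI R).
    have c11 := cont_on_comp c1 (fun _ _ => I) (cont_on_fst setT).
    have c12 := cont_on_comp c1 (fun _ _ => I) (cont_on_snd setT).
    have ct : cont_on ((S `*` unitI) `*` unitI) tau.
      apply: cont_onD; first exact: cont_onM (cont_on_cst _ _) c12.
      apply: cont_onM c2 _; apply: cont_onD (cont_on_cst _ _) _.
      by apply: cont_onN; exact: cont_onM (cont_on_cst _ _) c12.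
    apply: cont_on_if => //.
    + by do 2 apply: closedX => //.
    + apply: cbt; first by apply: cont_on_comp c11 _ ca => q [[]].
      apply: cont_on_min.
        apply: cont_onD ct _; apply: cont_onN.
        exact: cont_onM (cont_on_cst _ _) c2.
      by apply: cont_onD (cont_on_cst _ _) _; exact: cont_onN.
    + by apply: ch' c11 _ _; [exact: cont_onD ct (cont_on_cst _ _)|
        move=> q [[]]].
    + move=> [[x t] w] [[/= Sx It] /andP[w0 w1]] tq.
      by rewrite h'0 ?bt0//; [rewrite tq subrr min_r//; lra|rewrite tq subrr].
  - apply: (@cont_on_eq _ _ _ (fun q => P q.1)).
      apply: cont_on_comp (cont_on_fst _) _ cP => -[[x t] w] [[/= Dx t01] _].
      by split=> //; case: t01 => /= ->; [exact: unitI0|exact: unitI1].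
    move=> [[x t] w] [[/= Dx t01] Iw]; rewrite /M/=.
    by case: asboolP => // Sx; rewrite N_end.
have [|H [cH H0 HS]] := cell_homotopy_extension (cell_cylinder cDS) cP cM.
  move=> [x t] xt; rewrite /M/=; case: asboolP => // Sx.
  have It : unitI t.
    by case: xt => [[_ //]|[_ /= [->|->]]]; [exact: unitI0|exact: unitI1].
  have /andP[t0 t1] := It.
  rewrite /N/tau/P/= !mul0r !addr0 mulr0 subr0 a1S//.
  have [t1'|t1'] := leP (3 * t) 1.
    by rewrite ifT; [rewrite min_l//; lra|lra].
  rewrite clip_id; last by apply/andP; split; lra.
  rewrite GS//=; last by apply/andP; split; lra.
  have [t2|t2] := leP (3 * t) 2; last first.
    by rewrite ifT; [congr h'|]; lra.
  have [t3|t3] := leP (2 * ((3 - 3 * t) / 2)) 1.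
    have -> : 3 * t = 2 by lra.
    by rewrite h'0// ?bt0//; [rewrite subrr min_r//; lra|lra].
  by congr bt; rewrite min_r; lra.
exists a1, (fun p => H (p, 1)); split=> //.
- split=> //; apply: cont_on_comp cH.
    exact: cont_on_pair (cont_on_id _) (cont_on_cst _ _).
  by move=> p Dp; split=> //; exact: unitI1.
- move=> x t Sx It; rewrite HS//; [|by left|exact: unitI1].
  have /andP[t0 t1] := It.
  rewrite /M/= asboolT// /N/tau/= mul1r.
  have e : 3 * t + (2 - 2 * t) = 2 + t by lra.
  rewrite e; case: leP => t2.
    have -> : t = 0 by lra.
    rewrite bt0; last by rewrite min_l; lra.
    by case: (hab x Sx).
  by rewrite /h' [X in clip X](_ : _ = t) ?clip_id//; lra.
- move=> x Dx.
  have e t : t = 0 \/ t = 1 -> H ((x, t), 1) = P (x, t).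
    move=> t01; rewrite HS; [|by right|exact: unitI1].
    by rewrite /M/=; case: asboolP => // Sx; rewrite N_end//; exact: unitI1.
  by rewrite !e ?P0 ?P1//; [right|left].
Qed.

End homotopic_to_identity.

Lemma homotopic_idP (X : topologicalType) (phi : X -> X) :
  homotopic R phi idfun -> exists beta : X * R -> X,
    [/\ cont_on (setT `*` unitI) beta, forall x, beta (x, 0) = phi x &
        forall x, beta (x, 1) = x].
Proof.
by move=> [H [cH H0 H1]]; exists H; split=> //; rewrite cont_onE unitIE.
Qed.

(* Lifting along f' f produces a' and a homotopy from f' f a' to f' b; its image
   under f extends the boundary data composed with f f', so the extension
   property of f f' provides the required homotopy from f a' to b. *)
Lemma homotopy_equivalence_lifting (X Y E : topologicalType) (D S : set E)
    (f : X -> Y) :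
  cell R D S -> homotopy_equivalence R f -> lifting D S f.
Proof.
move=> cDS [cf [f' [cf' /homotopic_idP[al [cal al0 al1]]
  /homotopic_idP[be [cbe be0 be1]]]]] a b h ca cb ch hab.
have [] := homotopic_id_lifting cal al0 al1 cDS ca (cont_on_compT cb cf')
  (cont_on_compT ch cf').
  by move=> x /hab[-> ->].
move=> a' [H1 [[ca' cH1] a'S H1S H1e]].
pose M (p : E * R) := if `[< S p.1 >] then h p
  else if p.2 == 0 then f (a' p.1) else b p.1.
have M0 x : D x -> M (x, 0) = f (a' x).
  move=> Dx; rewrite /M/= eqxx; case: asboolP => // Sx.
  by rewrite a'S//; case: (hab x Sx).
have M1 x : D x -> M (x, 1) = b x.
  move=> Dx; rewrite /M/= oner_eq0; case: asboolP => // Sx.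
  by case: (hab x Sx).
have cD := cell_closed cDS; have cS := cell_boundary_closed cDS.
have cM : cont_on (cylinder_boundary D S) M.
  have -> : cylinder_boundary D S =
      (S `*` unitI) `|` ((D `*` [set (0 : R)]) `|` (D `*` [set 1])).
    apply/seteqP; split=> -[x t] /=; rewrite /cylinder_boundary/=; tauto.
  have c1 : closed [set (1 : R)] by exact: closed_eq.
  apply: cont_on_paste.
  - by apply: closedX => //; exact: closed_unitI.
  - by apply: closedU; apply: closedX => //; exact: closed_zero.
  - by apply: (cont_on_eq ch) => p [Sp _]; rewrite /M asboolT.
  - apply: cont_on_paste.
    + by apply: closedX => //; exact: closed_zero.
    + exact: closedX.
    + apply: (@cont_on_eq _ _ _ (fun p => f (a' p.1))).
        apply: cont_on_compT cf.
        by apply: cont_on_comp (cont_on_fst _) _ ca' => p [].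
      by move=> [x t] [/= Dx ->]; rewrite M0.
    + apply: (@cont_on_eq _ _ _ (fun p => b p.1)).
        by apply: cont_on_comp (cont_on_fst _) _ cb => p [].
      by move=> [x t] [/= Dx ->]; rewrite M1.
have [|H cH HM] := homotopic_id_extension cbe be0 be1 (cell_cylinder cDS) cM
  (cont_on_compT cH1 cf).
- move=> [x t] [[/= Sx It]|[/= Dx [->|->]]] /=.
  + by rewrite H1S// /M/= asboolT.
  + by rewrite M0//; case: (H1e x Dx) => ->.
  + by rewrite M1//; case: (H1e x Dx) => _ ->.
exists a', H; split=> //.
- by move=> x t Sx It; rewrite HM; [rewrite /M/= asboolT|left].
- by move=> x Dx; rewrite !HM ?M0 ?M1//; right; split=> //; [right|left].
Qed.

End lifting.

Arguments lifting R {X Y E} D S f.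

(** * Topology of geometric realizations *)

Lemma eq_big_fset_support (R : realType) (T : choiceType) (s t : {fset T})
    (g : T -> R) :
  (forall v, v \in s -> v \notin t -> g v = 0) ->
  (forall v, v \in t -> v \notin s -> g v = 0) ->
  \sum_(v <- s) g v = \sum_(v <- t) g v.
Proof.
have aux (u w : {fset T}) : (forall v, v \in u -> v \notin w -> g v = 0) ->
    \sum_(v <- u) g v = \sum_(v <- (u `&` w)%fset) g v.
  move=> uw; rewrite [RHS](_ : _ = \sum_(v <- [seq v <- u | v \in w]) g v).
    rewrite big_filter [RHS]big_mkcond/= !big_seq; apply: eq_bigr => v vu.
    by case: ifPn => // vw; exact: uw.
  apply: perm_big; apply: uniq_perm; rewrite ?filter_uniq ?fset_uniq// => v.
  by rewrite mem_filter in_fsetI andbC.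
by move=> st ts; rewrite (aux _ _ st) (aux _ _ ts) fsetIC.
Qed.

Lemma cont_on_prod_topology (R : realType) (T : choiceType)
    (E : topologicalType) (A : set E)
    (F : E -> prod_topology (fun _ : T => R)) :
  (forall v, cont_on A (fun e => F e v)) -> cont_on A F.
Proof.
move=> cF x Ax; apply/cvg_sup => v U [_ [[W oW <-] WFx WU]].
apply: filterS WU _; apply: (cF v x Ax).
exact: open_nbhs_nbhs.
Qed.

Section realization_topology.
Context {R : realType} {T : choiceType} {K : simplicial_complex T}.
Local Notation X := (realization R K).

Definition simplex (s : {fset T}) : set X :=
  [set x | closed_simplex s (coords x)].

Lemma realization_openE (A : set X) : open A = realization_open A.
Proof. by []. Qed.

Lemma coords_inj : injective (@coords R T K).
Proof. exact: val_inj. Qed.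

Lemma cont_on_coords (A : set X) :
  cont_on A (@coords R T K : X -> prod_topology (fun _ : T => R)).
Proof.
apply: continuous_cont_on; apply/continuousP => O oO.
by rewrite realization_openE => s Ks; exists O.
Qed.

Lemma cont_on_coord (A : set X) (v : T) : cont_on A (fun x : X => coords x v).
Proof.
apply: (cont_on_compT (k := fun f : prod_topology (fun _ : T => R) => f v)).
  exact: cont_on_coords.
exact: (@proj_continuous T (fun _ => R) v).
Qed.
Arguments cont_on_coord : clear implicits.

Lemma simplex_neq0 (s : {fset T}) (x : T -> R) :
  closed_simplex s x -> s != fset0.
Proof.
move=> [_ _ s1]; apply/eqP => s0; move: s1; rewrite s0 big_seq_fset0.
by move/eqP; rewrite eq_sym oner_eq0.
Qed.

Lemma carrier (x : X) : exists2 s, faces K s & simplex s x.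
Proof. by have /set_mem[s Ks sx] := valP x; exists s. Qed.

Lemma coords_ge0 (x : X) v : 0 <= coords x v.
Proof. by have [s _ []] := carrier x. Qed.

(** Nonnegativity and total mass 1 are inherited from any face carrying [x], so only the vanishing
    outside [s] is left to test; [s] itself may fail to be a face. *)
Lemma simplexP (s : {fset T}) (x : X) :
  simplex s x <-> forall v, v \notin s -> coords x v = 0.
Proof.
split=> [[]//|xs]; split=> //; first exact: coords_ge0.
have [t _ [_ xt <-]] := carrier x.
by apply: eq_big_fset_support => v _; [exact: xt|exact: xs].
Qed.

Lemma simplexI (s t : {fset T}) (x : X) :
  simplex s x -> simplex t x -> simplex (s `&` t)%fset x.
Proof.
move=> /simplexP xs /simplexP xt; apply/simplexP => v.
by rewrite in_fsetI negb_and => /orP[/xs|/xt].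
Qed.

Lemma face_simplexI (s t : {fset T}) (x : X) :
  faces K s -> simplex s x -> simplex t x -> faces K (s `&` t)%fset.
Proof.
move=> Ks sx tx; apply: faces_sub Ks (fsubsetIl _ _) _.
exact: simplex_neq0 (simplexI sx tx).
Qed.

Lemma simplex_closed (s : {fset T}) : closed (simplex s).
Proof.
have -> : simplex s =
    \bigcap_(v in [set v | v \notin s]) [set x | coords x v \in [set 0]].
  apply/seteqP; split=> x.
    by move=> /simplexP xs v vs; rewrite /= inE; exact: xs.
  by move=> xs; apply/simplexP => v /xs/=; rewrite inE.
apply: closed_bigI => v _.
have /cont_on_closedP/(_ [set 0] (@closed_zero R))[P cP PE] :=
  cont_on_coord setT v.
by rewrite (_ : [set _ | _] = P)//; apply/seteqP; split=> x /=;
  rewrite inE => /PE; apply.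
Qed.
Arguments simplex_closed : clear implicits.

Lemma coherent_open (A : set X) :
  (forall s, faces K s -> exists2 P : set X, open P &
    forall x, simplex s x -> A x <-> P x) -> open A.
Proof.
move=> AP; rewrite realization_openE => s Ks; have [P] := AP s Ks.
rewrite realization_openE => /(_ s Ks)[O oO OP] PA.
by exists O => // x sx; rewrite (PA x sx); exact: OP.
Qed.

Lemma coherent_continuous (Y : topologicalType) (F : X -> Y) :
  (forall s, faces K s -> cont_on (simplex s) F) -> continuous F.
Proof.
move=> cF; apply/continuousP => O oO; apply: coherent_open => s Ks.
by have /cont_onP/(_ O oO) := cF s Ks.
Qed.

(** A product with a coherent topology need not be coherent; here compactness of intervals saves it,
    by the tube lemma. For a compact interval [J], the points x such that {x} x J is mapped into [O]
    form a set whose trace on each simplex is open. *)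
Lemma coherent_cylinder (Y : topologicalType) (F : X * R -> Y) :
  (forall s, faces K s -> cont_on (simplex s `*` unitI) F) ->
  cont_on (setT `*` unitI) F.
Proof.
move=> cF.
(* Extending the parameter to all reals avoids one-sided neighbourhoods at 0 and 1. *)
pose G (p : X * R) := F (p.1, clip p.2).
suff cG : continuous G.
  apply: (cont_on_eq (continuous_cont_on cG)) => -[x t] [_ It].
  by rewrite /G/= clip_id.
have {}cF s : faces K s -> cont_on (simplex s `*` setT) G.
  move=> Ks; apply: cont_on_clip_homotopy (cF s Ks) (cont_on_fst _) _ _.
    by move=> p [].
  exact: cont_on_snd.
apply/continuousP => O oO; rewrite openE => -[x0 t0] Ox0.
have [s0 Ks0 sx0] := carrier x0.
have cx0 : continuous (fun t => G (x0, t)).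
  apply: cont_onT; apply: cont_on_comp (cF _ Ks0); last by [].
  exact: cont_on_pair (cont_on_cst _ _) (cont_on_id _).
have /nbhs_ballP[e e0 eO] : nbhs t0 (fun t => O (G (x0, t))).
  by apply: cx0; exact: open_nbhs_nbhs.
(* Half the radius keeps the closed interval inside the open ball of radius [e]. *)
pose J : set R := `[t0 - e / 2, t0 + e / 2]%classic.
have JO t : J t -> O (G (x0, t)).
  rewrite /J/= in_itv/= => /andP[t1 t2]; apply: eO.
  rewrite /ball/= ltr_norml; apply/andP; split; move: e0 => /=; lra.
pose U := [set x | forall t, J t -> O (G (x, t))].
have oU : open U.
  apply: coherent_open => s Ks.
  have /cont_onP/(_ O oO)[P oP PO] := cF s Ks.
  exists [set x | forall t, J t -> P (x, t)]; last first.
    by move=> x sx; split=> H t /H; [move/(PO (x, t) (conj sx I))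
      |move/(PO (x, t) (conj sx I))].
  rewrite openE => x Px.
  have /compact_near_coveringP cJ : compact J by exact: segment_compact.
  have := cJ X (nbhs x) (fun y t => P (y, t)) _ _.
  apply => t Jt.
  have [[V W] [/= Vx Wt] VWP] : nbhs (x, t) P.
    by apply: open_nbhs_nbhs; split=> //; exact: Px.
  by exists (W, V) => // -[t' y] [/= Wt' Vy]; apply: (VWP (y, t')).
exists (U, J) => /=.
  split; first by apply: open_nbhs_nbhs; split=> // t; exact: JO.
  apply/nbhs_ballP; exists (e / 2); first by rewrite /= divr_gt0.
  move=> t; rewrite /ball/= ltr_norml => /andP[t1 t2].
  by rewrite /J/= in_itv/=; apply/andP; split; lra.
by move=> [x t] [/= Ux Jt]; exact: Ux.
Qed.

(** Inside a single face the CW topology is the topology of coordinates. The common face [s]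
    matters: without it, continuity of the coordinates would not imply continuity of [F]. *)
Lemma cont_on_into_simplex (E : topologicalType) (A : set E) (F : E -> X)
    (s : {fset T}) : faces K s -> (forall e, A e -> simplex s (F e)) ->
  (forall v, cont_on A (fun e => coords (F e) v)) -> cont_on A F.
Proof.
move=> Ks As /cont_on_prod_topology cF; apply/cont_onP => O.
rewrite realization_openE => /(_ s Ks)[O' oO' OE].
have /cont_onP/(_ O' oO')[P oP PE] := cF.
by exists P => // e Ae; rewrite (OE _ (As e Ae)); exact: PE.
Qed.

(** The default [x0] is returned when [x] is not the coordinate vector of a point. *)
Definition point_at (x0 : X) (x : T -> R) : X := insubd x0 x.

Lemma coords_point_at (s : {fset T}) (x0 : X) (x : T -> R) :
  faces K s -> closed_simplex s x -> coords (point_at x0 x) = x.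
Proof.
move=> Ks sx; rewrite /point_at /coords insubdK//.
by apply/mem_set; exists s.
Qed.

End realization_topology.

Arguments cont_on_coord {R T K} A v.
Arguments simplex_closed {R T K} s.

(** * Simplices as cells *)

Section simplex_cell.
Context {R : realType} {T : choiceType} {K : simplicial_complex T}.
Local Notation X := (realization R K).
Context (s : {fset T}) (Ks : faces K s).

Definition simplex_boundary : set X :=
  [set x | simplex s x /\ exists2 v, v \in s & coords x v = 0].

Let n : R := (#|` s|)%:R.

Let n_gt0 : 0 < n.
Proof. by rewrite ltr0n cardfs_gt0; exact: faces_neq0 Ks. Qed.

(** The ambient product may have infinitely many factors, so compactness comes from Tychonoff's
    theorem for the cube, of which the simplex is a closed subset. *)
Lemma compact_closed_simplex :
  compact (@closed_simplex R T s : set (prod_topology (fun _ : T => R))).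
Proof.
have kI : compact [set f : prod_topology (fun _ : T => R) |
    forall v, `[0, 1]%classic (f v)].
  apply: (@tychonoff T (fun _ => R) (fun _ => `[0, 1]%classic)) => v.
  exact: segment_compact.
pose evT (v : T) : prod_topology (fun _ : T => R) -> R := fun f => f v.
have cev v : continuous (evT v) by exact: (@proj_continuous T (fun _ => R) v).
apply: (subclosed_compact _ kI); last first.
  move=> x [x0 xs x1] v; rewrite /= in_itv/= x0/=.
  have [vs|/xs -> //] := boolP (v \in s).
  rewrite -x1 (big_fsetD1 v)//= lerDl; exact: sumr_ge0.
have -> : (@closed_simplex R T s : set (prod_topology (fun _ : T => R))) =
    (\bigcap_(v in setT) (evT v @^-1` [set r | 0 <= r])) `&`
    ((\bigcap_(v in [set v | v \notin s]) (evT v @^-1` [set 0])) `&`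
    ((fun f => \sum_(v <- s) evT v f) @^-1` [set 1])).
  apply/seteqP; split=> x.
    move=> [x0 xs x1]; split; first by move=> v _; exact: x0.
    by split=> // v; exact: xs.
  by move=> [x0 [xs x1]]; split=> // v; exact: x0.
apply: closedI; last apply: closedI.
- apply: closed_bigI => v _; apply: continuous_preimage_closed (cev v) _.
  exact: closed_ge.
- apply: closed_bigI => v _; apply: continuous_preimage_closed (cev v) _.
  exact: closed_eq.
- apply: continuous_preimage_closed; last exact: closed_eq.
  by apply: cont_onT; apply: cont_on_sum => v; exact: continuous_cont_on.
Qed.

Lemma compact_simplex : compact (simplex s : set X).
Proof.
have [[x0 _]|] := pselect (exists x : X, simplex s x); last first.
  move=> ns; suff -> : simplex s = set0 :> set X by exact: compact0.
  by apply/seteqP; split=> x // sx; apply: ns; exists x.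
have -> : simplex s = point_at x0 @` (@closed_simplex R T s).
  apply/seteqP; split=> x.
    move=> sx; exists (coords x) => //; apply: coords_inj.
    exact: coords_point_at Ks sx.
  by move=> [y sy <-]; rewrite /simplex/= (coords_point_at _ Ks sy).
apply: (@continuous_compact (prod_topology (fun _ : T => R))); last first.
  exact: compact_closed_simplex.
apply/cont_onE; apply: (cont_on_into_simplex Ks) => [y sy|v].
  by rewrite /simplex/= (coords_point_at _ Ks sy).
apply: (@cont_on_eq _ _ _ (fun y : prod_topology (fun _ : T => R) => y v)).
  by apply: continuous_cont_on; exact: (@proj_continuous T (fun _ => R) v).
by move=> y sy; rewrite (coords_point_at _ Ks sy).
Qed.

(** On the simplex, [1 - m] is the Minkowski functional about the barycentre, whose coordinates are
    all 1 / n. The base value 1 is fixed by a |-> 1 - l (1 - a), so a homothety acts on the minimum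
    as it acts on each entry. *)
Let m (x : X) : R := \big[Num.min/1]_(v <- s) (n * coords x v).

Let homothety (p : X * R) : X := point_at p.1
  (fun v => if v \in s then n^-1 + p.2 * (coords p.1 v - n^-1) else 0).

Let m_le (x : X) v : v \in s -> m x <= n * coords x v.
Proof.
rewrite /m -[v \in s]/(v \in enum_fset s).
elim: (enum_fset s) => [//|w r IH]; rewrite inE big_cons ge_min.
by move=> /orP[/eqP ->|/IH ->]; rewrite ?lexx ?orbT.
Qed.

Let homothety_simplex (p : X * R) : scalable (simplex s) m p ->
  closed_simplex s
    (fun v => if v \in s then n^-1 + p.2 * (coords p.1 v - n^-1) else 0).
Proof.
move=> [sx l0 l1]; split.
- move=> v; case: ifP => // vs; rewrite -(pmulr_rge0 _ n_gt0).
  have -> : n * (n^-1 + p.2 * (coords p.1 v - n^-1)) =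
      1 - p.2 * (1 - n * coords p.1 v).
    by field; rewrite gt_eqF.
  rewrite subr_ge0; apply: le_trans l1; rewrite ler_wpM2l// lerD2l lerN2.
  exact: m_le.
- by move=> v /negbTE ->.
- rewrite big_seq (eq_bigr (fun v => n^-1 + p.2 * (coords p.1 v - n^-1))).
    rewrite -big_seq big_split/= -mulr_sumr big_split/= sumrN.
    have [_ _ ->] := sx.
    have -> : \sum_(v <- s) n^-1 = 1.
      rewrite big_const_seq count_predT iter_addr_0 -mulr_natr.
      by rewrite mulVf// gt_eqF.
    by rewrite subrr mulr0 addr0.
  by move=> v ->.
Qed.

Lemma cell_simplex : cell R (simplex s : set X) simplex_boundary.
Proof.
split; [exact: simplex_closed|exact: compact_simplex|].
exists m, homothety; split; first split.
- rewrite /m; elim: (enum_fset s) => [|v r IH].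
    apply: (cont_on_eq (cont_on_cst _ (1 : R))) => x _; by rewrite big_nil.
  apply: (@cont_on_eq _ _ _ (fun x : X => Num.min (n * coords x v)
    (\big[Num.min/1]_(v <- r) (n * coords x v)))).
    apply: cont_on_min IH; apply: cont_onM (cont_on_cst _ _) _.
    exact: cont_on_coord.
  by move=> x _; rewrite big_cons.
- apply: (cont_on_into_simplex Ks) => [p sp|v].
    have h := homothety_simplex sp.
    by rewrite /simplex/= (coords_point_at _ Ks h).
  apply: (@cont_on_eq _ _ _ (fun p : X * R =>
      if v \in s then n^-1 + p.2 * (coords p.1 v - n^-1) else 0)).
    case: (v \in s); last exact: (cont_on_cst _ (0 : R)).
    apply: cont_onD (cont_on_cst _ _) _; apply: cont_onM (cont_on_snd _) _.
    apply: cont_onD (cont_on_cst _ _).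
    by apply: cont_on_comp (cont_on_fst _) _ (cont_on_coord setT v).
  by move=> p /homothety_simplex h; rewrite (coords_point_at _ Ks h).
- move=> x sx; apply/andP; split; rewrite /m.
    elim/big_ind : _ => [//|a b a0 b0|v _]; first by rewrite le_min a0.
    by rewrite mulr_ge0 ?coords_ge0// ltW.
  elim: (enum_fset s) => [|v r IH]; first by rewrite big_nil.
  by rewrite big_cons ge_min IH orbT.
- move=> x; split=> [[sx [v vs xv]]|[sx m0]].
    split=> //; apply/eqP; rewrite eq_le; apply/andP; split.
      by apply: le_trans (m_le x vs) _; rewrite xv mulr0.
    rewrite /m; elim/big_ind : _ => [//|a b a0 b0|w _].
      by rewrite le_min a0.
    by rewrite mulr_ge0 ?coords_ge0// ltW.
  split=> //; apply: contrapT => nv.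
  suff : 0 < m x by rewrite m0 ltxx.
  rewrite /m big_seq; elim/big_ind : _ => [//|a b a0 b0|v vs].
    by rewrite lt_min a0.
  rewrite mulr_gt0// lt_neqAle coords_ge0 andbT eq_sym.
  by apply/eqP => xv; apply: nv; exists v.
- move=> p sp; have h := homothety_simplex sp; split.
    by rewrite /simplex/= (coords_point_at _ Ks h).
  have [_ l0 _] := sp.
  have mE (a b : R) : Num.min (1 - p.2 * (1 - a)) (1 - p.2 * (1 - b)) =
      1 - p.2 * (1 - Num.min a b).
    by case: (leP a b) => ab; [rewrite min_l//|rewrite min_r//];
      rewrite lerD2l lerN2 ler_wpM2l//; lra.
  rewrite /m /homothety (coords_point_at _ Ks h).
  rewrite [LHS]big_seq (eq_bigr (fun v => 1 - p.2 * (1 - n * coords p.1 v))).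
    rewrite -big_seq; elim: (enum_fset s) => [|v r IH].
      by rewrite !big_nil subrr mulr0 subr0.
    by rewrite !big_cons IH mE.
  by move=> v ->; field; rewrite gt_eqF.
- move=> x sx; apply: coords_inj.
  have sc : scalable (simplex s) m (x, 1).
    split=> //=; rewrite mul1r gerBl /m.
    elim/big_ind : _ => [//|a b a0 b0|v _]; first by rewrite le_min a0.
    by rewrite mulr_ge0 ?coords_ge0// ltW.
  rewrite /homothety (coords_point_at _ Ks (homothety_simplex sc)).
  apply/funext => v /=; rewrite mul1r addrC subrK.
  by case: ifPn => // /negbTE vs; have [_ -> //] := sx; rewrite vs.
Qed.

End simplex_cell.

(** * Supports of compact sets *)

Section compact_support.
Context {R : realType} {T : choiceType} {K : simplicial_complex T}.
Local Notation X := (realization R K).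

Definition support (x : X) : set T := [set v | coords x v != 0].

Lemma bigcup_support_vertices (C : set X) :
  \bigcup_(x in C) support x `<=` vertices K.
Proof.
move=> v [x _ xv]; have [s Ks /simplexP xs] := carrier x.
apply: (faces_sub Ks); last by apply/fset0Pn; exists v; rewrite inE.
by rewrite fsub1set; apply: contraNT xv => /xs ->.
Qed.

(* Otherwise a locally finite weighted sum of barycentric coordinates would be
   a continuous function that is unbounded on C. *)
Lemma compact_support_finite (C : set X) : compact C ->
  finite_set (\bigcup_(x in C) support x).
Proof.
move=> kC; apply: contrapT => /infiniteP/card_leP[F].
pose f (i : nat) : T := \val (F (to_setT i)).
have /choice[y yf] : forall i : nat, exists y, C y /\ coords y (f i) != 0.
  by move=> i; have /set_mem[y Cy yi] := valP (F (to_setT i)); exists y.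
have finj : injective f.
  by move=> i j /val_inj/inj; rewrite !inE => /(_ I I)/(congr1 val).
(* The weight at [f i] makes the term of [phi (y i)] at [f i] equal to i; all terms are nonnegative,
   hence [phi (y i)] is at least i. *)
pose c v : R := match pselect (exists i, f i = v) with
  | left e => (projT1 (cid e))%:R / coords (y (projT1 (cid e))) v
  | right _ => 0 end.
have c_ge0 v : 0 <= c v.
  rewrite /c; case: pselect => // e; rewrite mulr_ge0// invr_ge0.
  exact: coords_ge0.
have cE i : c (f i) * coords (y i) (f i) = i%:R.
  rewrite /c; case: pselect => [e|]; last by case; exists i.
  case: cid => /= j /finj ->; rewrite divfK//.
  by case: (yf i).
have /choice[sp spE] : forall x : X, exists s, faces K s /\ simplex s x.
  by move=> x; have [s Ks sx] := carrier x; exists s.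
(* The sum runs over a chosen carrier, but by [phiE] any simplex containing x gives the same value;
   on each face it is a fixed finite sum, whence continuity. *)
pose phi (x : X) : R := \sum_(v <- sp x) c v * coords x v.
have phiE s x : simplex s x -> phi x = \sum_(v <- s) c v * coords x v.
  have [_ /simplexP px] := spE x.
  move=> /simplexP sx; apply: eq_big_fset_support => v _ ?.
    by rewrite sx// mulr0.
  by rewrite px// mulr0.
have cphi : continuous phi.
  apply: coherent_continuous => s Ks.
  apply: (@cont_on_eq _ _ _ (fun x => \sum_(v <- s) c v * coords x v)).
    apply: cont_on_sum => v; apply: cont_onM (cont_on_cst _ _) _.
    exact: cont_on_coord.
  by move=> x sx; rewrite (phiE s).
have : compact (phi @` C).
  by apply: continuous_compact => //; exact: continuous_subspaceT.
move=> /compact_bounded[M [_ /(_ (M + 1))]].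
rewrite ltrDl ltr01 => /(_ isT) Mb.
pose i := (Num.truncn `|M + 1|).+1.
have [Cy yi] := yf i.
have /= := Mb (phi (y i)) (ex_intro2 _ _ _ Cy erefl).
apply/negP; rewrite -ltNge; apply: lt_le_trans (ler_norm _).
apply: (@lt_le_trans _ _ i%:R).
  by apply: le_lt_trans (ler_norm _) _; rewrite truncnS_gt.
rewrite -cE /phi; have [_ /simplexP px] := spE (y i).
have fi : f i \in sp (y i) by apply: contraNT yi => /px ->.
rewrite (big_fsetD1 (f i))//= lerDl; apply: sumr_ge0 => v _.
by rewrite mulr_ge0//; exact: coords_ge0.
Qed.

End compact_support.

Section realize_continuous.
Context {R : realType} {T U : choiceType}.
Context {L : simplicial_complex T} {K : simplicial_complex U}.
Context (g : simplicial_map L K).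

Lemma realize_continuous : continuous (realize R g).
Proof.
apply: coherent_continuous => s Ls.
apply: (cont_on_into_simplex (vertex_map_faces g Ls)) => [x sx|w].
  exact: push_coords_simplex.
apply: (@cont_on_eq _ _ _ (fun x => \sum_(v <- s)
   (if g v == w then coords x v else 0))).
  apply: cont_on_sum => v; case: (g v == w); first exact: cont_on_coord.
  exact: (cont_on_cst _ (0 : R)).
by move=> x sx; rewrite -big_mkcond/= -(push_coordsE _ _ sx).
Qed.

End realize_continuous.

(** * Induced subcomplexes as subspaces *)

Section induced_subcomplex.
Context {R : realType} {T : choiceType} (K : simplicial_complex T) (A : set T).
Local Notation X := (realization R K).
Local Notation XA := (realization R (induced K A)).

Let induced_incl_subproof (x : XA) :
  coords x \in \bigcup_(s in faces K) @closed_simplex R T s.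
Proof. by have [s [Ks _] sx] := carrier x; apply/mem_set; exists s. Qed.

Definition induced_incl (x : XA) : X :=
  exist _ (coords x) (induced_incl_subproof x).

Lemma coords_induced_incl (x : XA) : coords (induced_incl x) = coords x.
Proof. by []. Qed.

Lemma induced_incl_inj : injective induced_incl.
Proof.
by move=> x y xy; apply: coords_inj; rewrite -!coords_induced_incl xy.
Qed.

Lemma induced_incl_continuous : continuous induced_incl.
Proof.
apply: coherent_continuous => s [Ks _].
by apply: (cont_on_into_simplex Ks) => // v; exact: cont_on_coord.
Qed.

(** An induced subcomplex is full: those vertices of a carrier of [x] that lie in [A] span a face of
    it, and this face already carries [x]. *)
Lemma induced_inclP (x : X) : support x `<=` A -> exists y, induced_incl y = x.
Proof.
move=> xA; have [t Kt tx] := carrier x.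
pose s := [fset v in t | v \in A]%fset.
have sx : simplex s x.
  apply/simplexP => v; rewrite !inE/= => vs; apply: contrapT => /eqP xv.
  case/negP: vs; apply/andP; split; last by apply/mem_set; exact: xA.
  by apply: contraNT xv => /(simplexP t x).1 ->.
have Ks : faces (induced K A) s.
  split.
    apply: (faces_sub Kt); last exact: simplex_neq0 sx.
    by apply/fsubsetP => v; rewrite !inE => /andP[].
  by move=> v /=; rewrite !inE => /andP[_ /set_mem].
have xx : coords x \in \bigcup_(s in faces (induced K A)) @closed_simplex R T s.
  by apply/mem_set; exists s.
by exists (exist _ (coords x) xx); apply: coords_inj.
Qed.

(** The inclusion is an embedding: an open [O] of the subcomplex is the trace of [O'], the union of
    its image with the complement of the subcomplex. On a face [t], a point either has a nonzero
    coordinate outside [A], which is the open condition [N], or lies in the face [s] spanned by the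
    vertices in [A], where openness of [O] applies. *)
Lemma cont_on_induced_incl (E : topologicalType) (B : set E) (F : E -> XA) :
  cont_on B (fun e => induced_incl (F e)) -> cont_on B F.
Proof.
move=> cF; apply/cont_onP => O oO.
pose O' : set X := [set y | forall z, induced_incl z = y -> O z].
suff oO' : open O'.
  have /cont_onP/(_ O' oO')[P oP PE] := cF; exists P => // e Be.
  rewrite -(PE e Be); split=> [Oe z /induced_incl_inj -> //|]; exact.
rewrite realization_openE => t Kt.
pose s := [fset v in t | v \in A]%fset.
pose N : set (prod_topology (fun _ : T => R)) :=
  \bigcup_(v in [set v | v \in t /\ ~ A v]) [set f | f v != 0].
have oN : open N.
  apply: bigcup_open => v _.
  have cv : continuous (fun f : prod_topology (fun _ : T => R) => f v).
    exact: (@proj_continuous T (fun _ => R) v).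
  apply: (continuous_preimage_open (O := [set r : R | r != 0]) cv).
  exact: open_neq.
have sE x : simplex t x -> ~ N (coords x) -> simplex s (x : X).
  move=> /simplexP tx nN; apply/simplexP => v; rewrite !inE/= => vs.
  have [vt|/tx//] := boolP (v \in t); move: vs; rewrite vt/= => /negP vA.
  apply: contrapT => /eqP xv; apply: nN; exists v => //; split=> //.
  by move=> Av; apply: vA; exact/mem_set.
have NE (z : XA) : ~ N (coords z).
  move=> [v [_ nA] /eqP]; apply.
  have [u [_ uA] /simplexP uz] := carrier z; apply: uz.
  by apply: contra_notN nA => vu; exact: uA.
(* If [t] has no vertex in [A], its simplex misses the subcomplex and lies entirely in [O']. *)
have [s0|s0] := eqVneq s fset0.
  exists setT; first exact: openT.
  move=> x tx; split=> // _ z zx; exfalso.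
  have /sE : simplex t x by [].
  have nN : ~ N (coords x) by rewrite -zx; exact: NE.
  by move=> /(_ nN)/simplex_neq0; rewrite s0 eqxx.
have Ks : faces (induced K A) s.
  split.
    apply: (faces_sub Kt) => //; apply/fsubsetP => v.
    by rewrite !inE => /andP[].
  by move=> v /=; rewrite !inE => /andP[_ /set_mem].
have := oO; rewrite realization_openE => /(_ s Ks)[Q oQ QE].
exists (Q `|` N); first exact: openU.
move=> x tx; split.
  move=> O'x; have [Nx|nN] := pselect (N (coords x)); [by right|left].
  have [z zx] : exists z, induced_incl z = x.
    apply: induced_inclP => v xv; apply: contrapT => nA; apply: nN.
    exists v => //.
    by split=> //; apply: contraNT xv => /(simplexP t x).1 ->.
  rewrite -zx; apply/QE; last exact: O'x.
  by have := sE x tx nN; rewrite -zx.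
move=> Qx z zx; have nN : ~ N (coords x) by rewrite -zx; exact: NE.
case: Qx => // Qx; apply/(QE z); last by move: Qx; rewrite -zx.
by have := sE x tx nN; rewrite -zx.
Qed.

End induced_subcomplex.

(** * Cell-by-cell construction *)

Section finite_stages.
Context {R : realType} {T U : choiceType}.
Context {L : simplicial_complex T} {K : simplicial_complex U}.
Context (g : simplicial_map L K).

Lemma induced_incl_realize (A : set T) (x : realization R (induced L A)) :
  induced_incl (realize R (induced_map g A) x) = realize R g (induced_incl x).
Proof. exact: coords_inj. Qed.

Hypothesis finite_equivalences : forall (V0 : set T) (W0 : set U),
  finite_set V0 -> V0 `<=` vertices L -> finite_set W0 -> W0 `<=` vertices K ->
  exists V1 : set T, [/\ finite_set V1, V0 `<=` V1 /\ V1 `<=` vertices L,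
    W0 `<=` g @` V1 /\ g @` V1 `<=` vertices K &
    homotopy_equivalence R (realize R (induced_map g V1))].

Lemma finite_stages_lifting (E : topologicalType) (D S : set E) :
  cell R D S -> lifting R D S (realize R g).
Proof.
move=> cDS a b h ca cb ch hab.
have SD := cell_sub cDS.
have [[x0 Dx0]|nD] := pselect (exists x, D x); last first.
  exists a, (fun p => b p.1); split; first split.
  - by move=> x Dx; case: nD; exists x.
  - by move=> p [Dp _]; case: nD; exists p.1.
  - by [].
  - by move=> x t /SD Dx; case: nD; exists x.
  - by move=> x Dx; case: nD; exists x.
pose CK := (b @` D) `|` (h @` (S `*` unitI)).
have kL : compact (a @` S).
  apply: continuous_compact; first exact/cont_onE.
  exact: cell_boundary_compact cDS.
have kK : compact CK.
  apply: compactU; apply: continuous_compact; try exact/cont_onE.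
    exact: cell_compact cDS.
  by apply: compact_setX; [exact: cell_boundary_compact cDS|
    exact: compact_unitI].
have [V1 [_ [V01 _] [W01 _] he]] := finite_equivalences
  (compact_support_finite kL) (@bigcup_support_vertices _ _ _ _)
  (compact_support_finite kK) (@bigcup_support_vertices _ _ _ _).
have suppL x : S x -> support (a x) `<=` V1.
  by move=> Sx; apply: subset_trans V01 => v xv; exists (a x) => //; exists x.
have suppb x : D x -> support (b x) `<=` g @` V1.
  move=> Dx; apply: subset_trans W01 => v xv; exists (b x) => //.
  by left; exists x.
have supph p : (S `*` unitI) p -> support (h p) `<=` g @` V1.
  move=> Sp; apply: subset_trans W01 => v xv; exists (h p) => //.
  by right; exists p.
(* [k0] and [l0] fill in values off [D] and [S]. As [S] may be empty, the point [l0] is taken from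
   the homotopy inverse of the stage. *)
have [_ [g1' _]] := he.
have [k0 _] := induced_inclP (suppb _ Dx0).
pose l0 := g1' k0.
have /choice[a1 a1E] : forall x, exists y : realization R (induced L V1),
    S x -> induced_incl y = a x.
  move=> x; have [Sx|nS] := pselect (S x); last by exists l0.
  by have [y yx] := induced_inclP (suppL _ Sx); exists y.
have /choice[b1 b1E] : forall x, exists y : realization R (induced K (g @` V1)),
    D x -> induced_incl y = b x.
  move=> x; have [Dx|nD] := pselect (D x); last by exists k0.
  by have [y yx] := induced_inclP (suppb _ Dx); exists y.
have /choice[h1 h1E] : forall p, exists y : realization R (induced K (g @` V1)),
    (S `*` unitI) p -> induced_incl y = h p.
  move=> p; have [Sp|nS] := pselect ((S `*` unitI) p); last by exists k0.
  by have [y yx] := induced_inclP (supph _ Sp); exists y.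
have ca1 : cont_on S a1.
  apply: cont_on_induced_incl; apply: (cont_on_eq ca) => x Sx.
  by rewrite a1E.
have cb1 : cont_on D b1.
  apply: cont_on_induced_incl; apply: (cont_on_eq cb) => x Dx.
  by rewrite b1E.
have ch1 : cont_on (S `*` unitI) h1.
  apply: cont_on_induced_incl; apply: (cont_on_eq ch) => p Sp.
  by rewrite h1E.
have [|a' [H [[ca' cH] a'S HS He]]] :=
    homotopy_equivalence_lifting cDS he ca1 cb1 ch1.
  move=> x Sx; have [h0 h1x] := hab x Sx; split; apply: induced_incl_inj.
    rewrite h1E; last by split=> //; exact: unitI0.
    by rewrite h0 induced_incl_realize a1E.
  rewrite h1E; last by split=> //; exact: unitI1.
  by rewrite h1x b1E//; exact: SD.
exists (fun x => induced_incl (a' x)), (fun p => induced_incl (H p)).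
split; first split.
- exact: cont_on_compT ca' (@induced_incl_continuous _ _ _ _).
- exact: cont_on_compT cH (@induced_incl_continuous _ _ _ _).
- by move=> x Sx; rewrite a'S// a1E.
- by move=> x t Sx It; rewrite HS// h1E.
- move=> x Dx; have [-> ->] := He x Dx.
  by rewrite induced_incl_realize b1E.
Qed.

End finite_stages.

(** * Extension over all cells by Zorn's lemma *)

Section cell_by_cell.
Context {R : realType} {V : choiceType} (M : simplicial_complex V).
Context {P X Y : topologicalType} (f : X -> Y).
Context (e bd : {fset V} -> set P) (A0 : set P).
Hypothesis cell_e : forall s, faces M s -> cell R (e s) (bd s).
Hypothesis lift_e : forall s, faces M s -> lifting R (e s) (bd s) f.
Hypothesis bdE : forall s x, faces M s ->
  bd s x <-> e s x /\ (A0 x \/ exists2 t, faces M t & (t `<` s)%fset /\ e t x).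
Hypothesis eI : forall s t x, faces M s -> e s x -> e t x ->
  faces M (s `&` t)%fset /\ e (s `&` t)%fset x.
Hypothesis closed_A0 : closed A0.
Context (a0 : P -> X) (b : P -> Y).
Hypothesis cont_a0 : cont_on A0 a0.
Hypothesis cont_b0 : cont_on A0 b.
Hypothesis cont_b : forall s, faces M s -> cont_on (e s) b.
Hypothesis a0b : forall x, A0 x -> f (a0 x) = b x.

Let data : Type := set {fset V} * (P -> X) * (P * R -> Y).

(** A partial solution over a set [F] of faces closed under passing to faces. The functions are
    total, but are constrained only on the cells of [F] and on [A0], where the homotopy is
    constant. *)
Let solution (d : data) : Prop :=
  let: (F, a, H) := d in
  [/\ F `<=` faces M,
      forall s t, F s -> faces M t -> (t `<=` s)%fset -> F t,
      forall s, F s -> cont_on (e s) a /\ cont_on (e s `*` unitI) H,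
      forall s x, F s -> e s x -> H (x, 0) = f (a x) /\ H (x, 1) = b x &
      forall x, A0 x -> a x = a0 x /\ forall t, unitI t -> H (x, t) = b x].

Let extends (d d' : data) : Prop :=
  d.1.1 `<=` d'.1.1 /\ forall s x, d.1.1 s -> e s x ->
    d.1.2 x = d'.1.2 x /\ forall t, unitI t -> d.2 (x, t) = d'.2 (x, t).

Let extends_trans (d2 d1 d3 : data) :
  extends d1 d2 -> extends d2 d3 -> extends d1 d3.
Proof.
move=> [F12 d12] [F23 d23]; split; first exact: subset_trans F23.
move=> s x F1s sx; have [-> H12] := d12 s x F1s sx.
have [-> H23] := d23 s x (F12 s F1s) sx; split=> // t It.
by rewrite H12// H23.
Qed.

Let chain_bound (C : set {d | solution d}) :
  total_on C (fun d d' => extends (sval d) (sval d')) ->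
  exists u : {d | solution d}, forall d, C d -> extends (sval d) (sval u).
Proof.
move=> Ctot.
pose near x (d : {d | solution d}) := C d /\ exists2 s, (sval d).1.1 s & e s x.
(* Members of the chain that cover x agree there, so any choice will do. The fallback handles points
   covered by none, also for an empty chain, and respects the values prescribed on [A0]. *)
pose pick x : data := match pselect (exists d, near x d) with
  | left ex => sval (projT1 (cid ex))
  | right _ => (set0, a0, fun p => b p.1) end.
have pickE d s x : C d -> (sval d).1.1 s -> e s x ->
    (pick x).1.2 x = (sval d).1.2 x /\
    forall t, unitI t -> (pick x).2 (x, t) = (sval d).2 (x, t).
  move=> Cd ds sx; rewrite /pick; case: pselect => [ex|]; last first.
    by case; exists d; split=> //; exists s.
  case: cid => d' [Cd' [s' d's' s'x]] /=.
  have [[_ dd']|[_ d'd]] := Ctot _ _ Cd Cd'.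
    have [-> HH] := dd' s x ds sx; split=> // t It.
    by rewrite HH.
  exact: d'd s' x d's' s'x.
pose u : data := (\bigcup_(d in C) (sval d).1.1, fun x => (pick x).1.2 x,
  fun p => (pick p.1).2 p).
have su : solution u.
  split=> /=.
  - by move=> s [[[[F a] H] sol] Cd /= Fs]; case: (sol) => + _ _ _ _; exact.
  - move=> s t [[[[F a] H] sol] Cd /= Fs] Mt ts.
    exists (exist _ (F, a, H) sol) => //=.
    by case: (sol) => _ + _ _ _; apply; [exact: Fs| |].
  - move=> s [d Cd ds].
    case: (d) Cd ds (pickE d s) => -[[F a] H] sol /= Cd Fs dE.
    case: (sol) => _ _ /(_ s Fs)[cas cHs] _ _; split.
      by apply: (cont_on_eq cas) => x sx; case: (dE x Cd Fs sx).
    apply: (cont_on_eq cHs) => -[x t] [/= sx It].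
    by case: (dE x Cd Fs sx) => _ ->.
  - move=> s x [d Cd ds] sx.
    case: (d) Cd ds (pickE d s x) => -[[F a] H] sol /= Cd Fs dE.
    have [-> HE] := dE Cd Fs sx.
    rewrite !HE; [|exact: unitI1|exact: unitI0].
    by case: (sol) => _ _ _ + _; apply; [exact: Fs|].
  - move=> x Ax; rewrite /pick; case: pselect => [ex|_] //=.
    case: cid => -[[[F a] H] sol] _ /=.
    by case: (sol) => _ _ _ _; apply.
exists (exist _ u su) => d Cd; split=> /=; first by move=> s ds; exists d.
move=> s x ds sx; have [-> HE] := pickE d s x Cd ds sx; split=> // t It.
by rewrite HE.
Qed.

Let extend_over_cell (d : data) (s : {fset V}) : solution d ->
  faces M s -> (forall t, faces M t -> (t `<` s)%fset -> d.1.1 t) ->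
  ~ d.1.1 s ->
  exists2 d', solution d' & extends d d' /\ d'.1.1 s.
Proof.
case: d => -[F a] H sol Ms /= sF nFs; have [FM Fd Fc Fe FA] := sol.
(* The proper faces of [s] are finitely many, so the boundary is covered by [A0] and finitely many
   closed cells, and continuity there follows by pasting. *)
pose r := [seq t <- enum_fset (fpowerset s) | (t != s) && `[< faces M t >]].
have rP t : t \in r -> F t.
  rewrite mem_filter => /andP[/andP[ts /asboolP Mt]].
  by rewrite fpowersetE => st; apply: sF => //; rewrite fproperEneq ts.
have bd_sub : bd s `<=` A0 `|` [set x | exists2 t, t \in r & e t x].
  move=> x /(bdE x Ms)[sx [Ax|[t Mt [ts tx]]]]; [by left|right].
  exists t => //; rewrite mem_filter -[t \in _]/(t \in fpowerset s) fpowersetE.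
  by rewrite (fproper_neq ts) (fproper_sub ts) andbT; exact/asboolP.
have ce t : t \in r -> closed (e t).
  by move=> /rP/FM/cell_e/cell_closed.
have ca : cont_on (bd s) a.
  apply: (cont_on_sub bd_sub).
  have [cU cUa] : closed [set x | exists2 t, t \in r & e t x] /\
      cont_on [set x | exists2 t, t \in r & e t x] a.
    by apply: cont_on_bigU => // t /rP/Fc[].
  apply: cont_on_paste => //.
  by apply: (cont_on_eq cont_a0) => x /FA[].
have cH : cont_on (bd s `*` unitI) H.
  have cI := @closed_unitI R.
  have [cU cUH] :
      closed [set p | exists2 t, t \in r & (e t `*` @unitI R) p] /\
      cont_on [set p | exists2 t, t \in r & (e t `*` unitI) p] H.
    apply: cont_on_bigU => t; last by move=> /rP/Fc[].
    by move=> /ce ct; exact: closedX.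
  apply: (@cont_on_sub _ _ _ ((A0 `*` unitI) `|`
      [set p | exists2 t, t \in r & (e t `*` unitI) p])).
    move=> -[x t] [/= /bd_sub[Ax|[u ur ux]] It]; first by left.
    by right; exists u.
  apply: cont_on_paste => //; first exact: closedX.
  apply: (@cont_on_eq _ _ _ (fun p => b p.1)).
    by apply: cont_on_comp (cont_on_fst _) _ cont_b0 => p [].
  by move=> -[x t] [/= Ax It]; case: (FA x Ax) => _ ->.
have [|a' [H' [[ca' cH'] a'S H'S H'e]]] := lift_e Ms ca (cont_b Ms) cH.
  move=> x /(bdE x Ms)[sx [Ax|[t Mt [ts tx]]]]; last exact: Fe (sF t Mt ts) tx.
  have [-> HA] := FA x Ax.
  by rewrite a0b// !HA//; [exact: unitI1|exact: unitI0].
(* If [s] were contained in [t], then [s] would belong to [F]. So the cells meet in that of a proper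
   face of [s], where old and new values coincide. *)
have agree t x : F t -> e t x -> e s x -> bd s x.
  move=> Ft tx sx; apply/(bdE x Ms); split=> //; right.
  have [Mst stx] := eI Ms sx tx.
  exists (s `&` t)%fset => //; split=> //.
  rewrite fproperEneq fsubsetIl andbT; apply: contra_notN nFs => /eqP st.
  by apply: Fd Ft Ms _; rewrite -st; exact: fsubsetIr.
pose a2 x := if `[< e s x >] then a' x else a x.
pose H2 p := if `[< e s p.1 >] then H' p else H p.
have a2E t x : F t -> e t x -> a2 x = a x.
  move=> Ft tx; rewrite /a2; case: asboolP => // sx.
  by apply: a'S; exact: agree Ft tx sx.
have H2E t x u : F t -> e t x -> unitI u -> H2 (x, u) = H (x, u).
  move=> Ft tx Iu; rewrite /H2/=; case: asboolP => // sx.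
  by apply: H'S => //; exact: agree Ft tx sx.
exists (F `|` [set s], a2, H2); last first.
  split; last by right.
  split=> /=; first by move=> t; left.
  by move=> t x Ft tx; rewrite (a2E t)//; split=> // u Iu; rewrite (H2E t).
split=> /=.
- by move=> t [/FM//|->].
- move=> t u [Ft|->] Mu ut; first by left; exact: Fd Ft Mu ut.
  have [->|us] := eqVneq u s; first by right.
  by left; apply: sF => //; rewrite fproperEneq us.
- move=> t [Ft|->].
    have [cat cHt] := Fc t Ft; split.
      by apply: (cont_on_eq cat) => x tx; rewrite (a2E t).
    by apply: (cont_on_eq cHt) => -[x u] [/= tx Iu]; rewrite (H2E t).
  split; first by apply: (cont_on_eq ca') => x sx; rewrite /a2 asboolT.
  by apply: (cont_on_eq cH') => -[x u] [/= sx Iu]; rewrite /H2 asboolT.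
- move=> t x [Ft|->] tx.
    have [e0 e1] := Fe t x Ft tx.
    rewrite (a2E t)// !(H2E t) => //; [exact: unitI1|exact: unitI0].
  by rewrite /a2 /H2 /= asboolT//; exact: H'e.
- move=> x Ax; have [aA HA] := FA x Ax; rewrite /a2 /H2 /=.
  case: asboolP => // sx.
  have bx : bd s x by apply/(bdE x Ms); split=> //; left.
  by rewrite a'S//; split=> // t It; rewrite H'S// HA.
Qed.

Theorem cell_by_cell_lifting : exists (a : P -> X) (H : P * R -> Y),
  [/\ forall s, faces M s -> cont_on (e s) a,
      forall s, faces M s -> cont_on (e s `*` unitI) H,
      forall x, A0 x -> a x = a0 x &
      forall s x, faces M s -> e s x -> H (x, 0) = f (a x) /\ H (x, 1) = b x].
Proof.
have sol0 : solution (set0, a0, fun p => b p.1).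
  by split=> //= x Ax.
(* [extends] ignores values off the cells, so it is not antisymmetric and the preorder form of
   Zorn's lemma is used. *)
have [|||[d sol] dmax] := @ZL_preorder {d | solution d} (exist _ _ sol0)
    (fun d d' => `[< extends (sval d) (sval d') >]).
- by move=> d; apply/asboolP; split.
- move=> d2 d1 d3 /asboolP d12 /asboolP d23; apply/asboolP.
  exact: extends_trans d12 d23.
- move=> C Ctot; have [|u uC] := @chain_bound C.
    by move=> d d' Cd Cd'; case: (Ctot d d' Cd Cd') => /asboolP; [left|right].
  by exists u => d Cd; apply/asboolP; exact: uC.
(* By induction on size, all proper faces of [s] are already covered; were [s] missing,
   [extend_over_cell] would contradict maximality. *)
have all s : faces M s -> d.1.1 s.
  have [n] := ubnP #|` s|; elim: n s => // n IH s sn Ms.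
  apply: contrapT => nds.
  have [|d' sol' [dd' d's]] := extend_over_cell sol Ms _ nds.
    move=> t Mt ts; apply: IH => //.
    exact: leq_trans (fproper_ltn_card ts) sn.
  have /asboolP[/= d'd _] := dmax (exist _ d' sol') (asboolT dd').
  by apply: nds; exact: d'd.
move: sol all {dmax}; case: d => -[F a] H [FM Fd Fc Fe FA] /= all.
exists a, H; split.
- by move=> s /all/Fc[].
- by move=> s /all/Fc[].
- by move=> x /FA[].
- by move=> s x /all; exact: Fe.
Qed.

End cell_by_cell.

(** * The homotopy inverse and the two homotopies *)

Lemma simplex_boundaryE (R : realType) (T : choiceType)
    (K : simplicial_complex T) (s : {fset T}) (x : realization R K) :
  faces K s -> simplex_boundary s x <->
  simplex s x /\ exists2 t, faces K t & (t `<` s)%fset /\ simplex t x.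
Proof.
move=> Ks; split=> [[sx [v vs xv]]|[sx [t _ [ts tx]]]]; split=> //.
  have tx : simplex (s `\ v)%fset x.
    apply/simplexP => w; rewrite !inE negb_and negbK => /orP[/eqP -> //|].
    exact: (simplexP s x).1.
  exists (s `\ v)%fset; last by split=> //; exact: fproperD1.
  by apply: faces_sub Ks (fsubsetDl _ _) _; exact: simplex_neq0 tx.
move: ts; rewrite fproperE => /andP[_ /fsubsetPn[v vs vt]].
by exists v => //; exact: (simplexP t x).1.
Qed.

Lemma homotopicI (R : realType) (X Y : topologicalType) (f g : X -> Y)
    (H : X * R -> Y) : cont_on (setT `*` unitI) H ->
  (forall x, H (x, 0) = f x) -> (forall x, H (x, 1) = g x) -> homotopic R f g.
Proof. by move=> cH H0 H1; exists H; split=> //; rewrite -unitIE -cont_onE. Qed.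

Theorem lemma3p5 (R : realType) (T U : choiceType)
    (L : simplicial_complex T) (K : simplicial_complex U)
    (g : simplicial_map L K) :
  (forall (V0 : set T) (W0 : set U),
     finite_set V0 -> V0 `<=` vertices L ->
     finite_set W0 -> W0 `<=` vertices K ->
     exists V1 : set T,
       [/\ finite_set V1,
           V0 `<=` V1 /\ V1 `<=` vertices L,
           W0 `<=` g @` V1 /\ g @` V1 `<=` vertices K &
           homotopy_equivalence R (realize R (induced_map g V1))]) ->
  homotopy_equivalence R (realize R g).
Proof.
move=> fin; have lift := finite_stages_lifting fin.
have cg := @realize_continuous R T U L K g.
split=> //.
(* Some function from |K| to |L| is needed as initial value. A stage whose image contains the
   support of [k] has a homotopy inverse, which yields a point of |L|. *)
have /choice[l0 _] : forall k : realization R K,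
    exists l : realization R L, True.
  move=> k; have kC := @compact_set1 (realization R K) k.
  have [V1 [_ _ [W01 _] [_ [g1' _]]]] := fin set0 _ (finite_set0 _)
    (@sub0set _ _) (compact_support_finite kC)
    (@bigcup_support_vertices _ _ _ _).
  have [|k1 _] := @induced_inclP R _ K (g @` V1) k.
    by apply: subset_trans W01 => v kv; exists k.
  by exists (induced_incl (g1' k1)).
have [|||||||||g' [H [cg' cH _ He]]] := @cell_by_cell_lifting R U K
    (realization R K) (realization R L) (realization R K) (realize R g)
    (@simplex R U K) (@simplex_boundary R U K) set0 _ _ _ _ _ l0 idfun.
- by move=> s Ks; exact: cell_simplex.
- by move=> s Ks; apply: lift; exact: cell_simplex.
- move=> s x Ks; rewrite simplex_boundaryE//.
  by split=> -[sx]; [split=> //; right|case].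
- move=> s t x Ks sx tx; split; last exact: simplexI.
  exact: face_simplexI sx tx.
- exact: closed0.
- by [].
- by [].
- by move=> s _; exact: cont_on_id.
- by [].
have {}cg' : continuous g' by exact: coherent_continuous.
have {}cH : cont_on (setT `*` unitI) H by exact: coherent_cylinder.
have H0 y : H (y, 0) = realize R g (g' y).
  by have [s Ks sy] := carrier y; case: (He s y Ks sy).
have H1 y : H (y, 1) = y.
  by have [s Ks sy] := carrier y; case: (He s y Ks sy).
exists g'; split=> //; last exact: homotopicI cH H0 H1.
(* The ends of the desired homotopy: g' |g| at 0 and the identity at 1. Applying |g| to them gives
   the ends of [b], so the map [a] obtained by extending [a0] over all simplex s x [0, 1] is that
   homotopy. *)
pose a0 (p : realization R L * R) : realization R L :=
  if p.2 <= 0 then g' (realize R g p.1) else p.1.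
pose b (p : realization R L * R) := H (realize R g p.1, p.2).
pose A0 : set (realization R L * R) := setT `*` [set 0; 1].
have c0 := @closed_zero R.
have c1 : closed [set (1 : R)] by exact: closed_eq.
have cA0 : closed A0 by apply: closedX closedT _; exact: closedU.
have cb : cont_on (setT `*` unitI) b.
  apply: cont_on_comp cH; last by move=> p [].
  apply: cont_on_pair (cont_on_snd _).
  exact: cont_on_compT (cont_on_fst _) cg.
have A0I : A0 `<=` setT `*` unitI.
  by move=> [x t] [_ /= [->|->]]; split=> //=; [exact: unitI0|exact: unitI1].
have [||||||||a [_ [ca _ aA _]]] := @cell_by_cell_lifting R T L
    (realization R L * R)%type (realization R L) (realization R K) (realize R g)
    (fun s => simplex s `*` unitI)
    (fun s => cylinder_boundary (simplex s) (simplex_boundary s)) A0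
    _ _ _ _ cA0 a0 b.
- by move=> s Ls; apply: cell_cylinder; exact: cell_simplex.
- by move=> s Ls; apply: lift; apply: cell_cylinder; exact: cell_simplex.
- move=> s [x t] Ls; split.
    move=> [[/(simplex_boundaryE _ Ls)[sx [u Lu [us ux]]] It]|[/= sx t01]].
      by split=> //; right; exists u.
    by split; [split=> //; apply: (A0I (x, t) _).2|left].
  move=> [[/= sx It] [[_ t01]|[u Lu [us [/= ux _]]]]]; first by right.
  by left; split=> //; apply/(simplex_boundaryE _ Ls); split=> //; exists u.
- move=> s t x Ls [sx Ix] [tx _]; split; first exact: face_simplexI sx tx.
  by split=> //; exact: simplexI.
- have -> : A0 = (setT `*` [set 0]) `|` (setT `*` [set 1]).
    by apply/seteqP; split=> -[x t] /=; rewrite /A0/=; tauto.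
  apply: cont_on_paste.
  + exact: closedX closedT c0.
  + exact: closedX closedT c1.
  + apply: (@cont_on_eq _ _ _ (fun p => g' (realize R g p.1))).
      apply: cont_on_compT cg'.
      exact: cont_on_compT (cont_on_fst _) cg.
    by move=> [x t] [_ /= ->]; rewrite /a0/= lexx.
  + apply: (cont_on_eq (cont_on_fst _)) => -[x t] [_ /= ->].
    by rewrite /a0/= ler10.
- exact: cont_on_sub A0I cb.
- by move=> s _; apply: cont_on_sub cb => p [].
- by move=> [x t] [_ /= [->|->]]; rewrite /a0/b/= ?lexx ?H0// ler10 H1.
apply: (homotopicI (H := a)).
- exact: coherent_cylinder.
- by move=> x; rewrite aA; [rewrite /a0/= lexx|split=> //; left].
- by move=> x; rewrite aA; [rewrite /a0/= ler10|split=> //; right].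
Qed.
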